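(* Assume $\Bbbk$ is uncountable. Every holonomic $A\mathcal{V}$-module $M$ is differentiable: the representation $\rho:\mathcal{V}\to\mathfrak{gl}(M)$ lies in $\mathrm{Diff}_s(\mathcal{V},\mathrm{End}_\Bbbk(M))$ for some $s\ge0$.
   Context: Setup: $\Bbbk$ algebraically closed, characteristic $0$; $A=\Bbbk[x_1,\dots,x_n]$; $\mathcal{V}=\mathrm{Der}(A)$. An $A\mathcal{V}$-module is an $A$-module and $\mathcal{V}$-module $M$ with $\eta(fm)=\eta(f)m+f(\eta m)$, i.e. a module over the smash product $A\#U(\mathcal{V})$; $\rho$ denotes the action map of $\mathcal{V}$. A finitely generated $A\mathcal{V}$-module is holonomic if it is $0$ or has Gelfand–Kirillov dimension $n$ over $A\#U(\mathcal{V})$ (GK dimension: $\limsup_m\log_m\dim(C^mM_0)$ for finite-dimensional generating subspaces $C\ni1$ of the algebra and $M_0$ of the module). Differential operators: for a commutative $\Bbbk$-algebra $R$ and $R$-modules $M',N'$, $\delta(f)D=D\circ f-f\circ D$ on $\mathrm{Hom}_\Bbbk(M',N')$; $\mathrm{Diff}_{-1}=0$, $\mathrm{Diff}_{s+1}(M',N')=\{D:\delta(f)D\in\mathrm{Diff}_s(M',N')\ \forall f\in R\}$. Here $R=A$, $\mathcal{V}$ is an $A$-module via $(f\eta)(g)=f\eta(g)$, and $\mathrm{End}_\Bbbk(M)$ is an $A$-module via $f\cdot T=f\circ T$, so $(\delta(f)\rho)(\eta)=\rho(f\eta)-f\circ\rho(\eta)$. *)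

(* Defs.v *)
From HB Require Import structures.
From mathcomp Require Import all_boot all_order all_algebra.
From mathcomp Require Import mpoly.
From mathcomp Require Import all_classical all_reals all_analysis.
From mathcomp Require Import Rstruct.
From Stdlib Require Rdefinitions.
Local Notation R := Rdefinitions.R.

Set Implicit Arguments.
Unset Strict Implicit.
Unset Printing Implicit Defensive.
Import Order.TTheory GRing.Theory Num.Theory.
Local Open Scope ring_scope.

Section AVDefs.
Variables (k : closedFieldType) (n : nat).

Local Notation A := (mpoly.mpoly n k).

Definition isDer (D : A -> A) : Prop :=
  (forall (a : k) (p q : A), D (a *: p + q) = a *: D p + D q) /\
  (forall p q : A, D (p * q) = D p * q + p * D q).

Definition Der := {D : A -> A | isDer D}.

Lemma derScale_proof (f : A) (eta : Der) : isDer (fun g => f * proj1_sig eta g).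
Proof.
case: eta => D [HL HD] /=; split.
  by move=> a p q; rewrite HL mulrDr scalerAr.
by move=> p q; rewrite HD mulrDr mulrA [f * _ * _]mulrC !mulrA [_ * f]mulrC.
Qed.

Definition derScale (f : A) (eta : Der) : Der :=
  exist _ (fun g => f * proj1_sig eta g) (derScale_proof f eta).

Variable M : lmodType k.

(* M is an A V-module (a module over A # U(V)), with A acting by actA and V by rho *)
Record isAVmodule (actA : A -> M -> M) (rho : Der -> M -> M) : Prop := {
  actA_addl : forall f g m, actA (f + g) m = actA f m + actA g m;
  actA_addr : forall f m m', actA f (m + m') = actA f m + actA f m';
  actA_mul : forall f g m, actA (f * g) m = actA f (actA g m);
  actA_const : forall (c : k) m, actA (mpoly.mpolyC n c) m = c *: m;
  rho_lin : forall eta (c : k) m m', rho eta (c *: m + m') = c *: rho eta m + rho eta m';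
  rho_klin : forall (c : k) (eta xi zeta : Der),
     proj1_sig zeta =1 (fun p => c *: proj1_sig eta p + proj1_sig xi p) ->
     forall m, rho zeta m = c *: rho eta m + rho xi m;
  rho_bracket : forall eta xi zeta : Der,
     proj1_sig zeta =1 (fun p => proj1_sig eta (proj1_sig xi p) - proj1_sig xi (proj1_sig eta p)) ->
     forall m, rho zeta m = rho eta (rho xi m) - rho xi (rho eta m);
  rho_leibniz : forall eta f m,
     rho eta (actA f m) = actA (proj1_sig eta f) m + actA f (rho eta m)
}.

(* the subalgebra of End_k(M) which is the image of A # U(V) *)
Inductive Bop (actA : A -> M -> M) (rho : Der -> M -> M) : (M -> M) -> Prop :=
  | Bop_A f : Bop actA rho (actA f)
  | Bop_V eta : Bop actA rho (rho eta)
  | Bop_id : Bop actA rho id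
  | Bop_comp T T' : Bop actA rho T -> Bop actA rho T' -> Bop actA rho (T \o T')
  | Bop_add T T' : Bop actA rho T -> Bop actA rho T' -> Bop actA rho (fun m => T m + T' m)
  | Bop_scale (c : k) T : Bop actA rho T -> Bop actA rho (fun m => c *: T m)
  | Bop_ext T T' : T =1 T' -> Bop actA rho T -> Bop actA rho T'.

Definition fin_gen (actA : A -> M -> M) (rho : Der -> M -> M) : Prop :=
  exists gens : seq M, forall P : M -> Prop,
    (forall x, x \in gens -> P x) ->
    P 0 ->
    (forall x y, P x -> P y -> P (x + y)) ->
    (forall (c : k) x, P x -> P (c *: x)) ->
    (forall f x, P x -> P (actA f x)) ->
    (forall eta x, P x -> P (rho eta x)) ->
    forall m, P m.

Definition lin_indep (s : seq M) : Prop :=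
  forall l : 'I_(size s) -> k,
    \sum_(i < size s) l i *: s`_i = 0 -> forall i, l i = 0.

Definition dimspan (s : seq M) : nat :=
  \max_(b : (size s).-tuple bool | `[< lin_indep (mask b s) >]) size (mask b s).

Definition op_in_span (cs : seq (M -> M)) (T : M -> M) : Prop :=
  exists l : 'I_(size cs) -> k, forall m, T m = \sum_(i < size cs) l i *: (cs`_i m).

Fixpoint words (cs : seq (M -> M)) (m : nat) : seq (M -> M) :=
  if m is m'.+1 then [seq c \o w | c <- cs, w <- words cs m'] else [:: id].

(* spanning family of C^m M0, for C = span cs and M0 = span ms *)
Definition CmM0 (cs : seq (M -> M)) (ms : seq M) (m : nat) : seq M :=
  [seq w x | w <- words cs m, x <- ms].

Definition growth (cs : seq (M -> M)) (ms : seq M) : \bar R :=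
  limn_esup (fun m : nat =>
    ((ln (dimspan (CmM0 cs ms m))%:R / ln (m%:R : R))%:E)).

Definition GKdim (actA : A -> M -> M) (rho : Der -> M -> M) : \bar R :=
  ereal_sup [set growth cs ms | cs in
               [set cs : seq (M -> M) | (forall c, c \in cs -> Bop actA rho c)
                                        /\ op_in_span cs id]
           & ms in [set: seq M]].

Definition holonomic (actA : A -> M -> M) (rho : Der -> M -> M) : Prop :=
  fin_gen actA rho /\ ((forall m : M, m = 0) \/ GKdim actA rho = (n%:R : R)%:E).

Definition delta (actA : A -> M -> M) (f : A) (D : Der -> M -> M) : Der -> M -> M :=
  fun eta m => D (derScale f eta) m - actA f (D eta m).

Definition der_klinear (D : Der -> M -> M) : Prop :=
  forall (c : k) (eta xi zeta : Der),
     proj1_sig zeta =1 (fun p => c *: proj1_sig eta p + proj1_sig xi p) ->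
     forall m, D zeta m = c *: D eta m + D xi m.

(* DiffS t = Diff_{t-1} (without linearity): DiffS 0 = Diff_{-1} = 0 *)
Fixpoint DiffS (actA : A -> M -> M) (t : nat) (D : Der -> M -> M) : Prop :=
  if t is t'.+1 then forall f : A, DiffS actA t' (delta actA f D)
  else forall eta m, D eta m = 0.

Definition Diff (actA : A -> M -> M) (s : nat) (D : Der -> M -> M) : Prop :=
  der_klinear D /\ DiffS actA s.+1 D.

End AVDefs.

Definition uncountable (T : Type) : Prop := ~ exists e : nat -> T, forall x : T, exists i : nat, e i = x.

(* Main.v *)
(* Over affine space [A # U(V)] contains the Weyl algebra D, and its commutant is generated by
   the operators [DD w (pd b)] (iterated commutators of [rho] with coordinates, evaluated at [d_b]),
   which form the Lie algebra L_+ of vector fields vanishing at the origin. Joseph's form of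
   Bernstein's inequality gives at least [m ^ n] dimensions in the first [O(m)] filtration steps of
   [D v], uniformly in [v] and modulo any D-submodule avoiding [v]. Hence GK dimension n forbids
   strict chains of D-submodules, ascending or descending, whose successive witnesses appear at
   linear speed. Such chains show in turn that M is finitely generated over D, that a surjective
   D-endomorphism of a finitely generated D-submodule is injective, and, k being uncountable, that
   the Euler element of L_+ satisfies a polynomial identity on M. Since an element of L_+ of degree
   d shifts the Euler eigenvalues by d, it acts by zero as soon as d is large. *)
Require Import Defs.
From HB Require Import structures.
From mathcomp Require Import all_boot all_order all_algebra.
From mathcomp Require Import mpoly.
From mathcomp Require Import boolp reals ereal exp Rstruct.
From mathcomp Require Import ring zify.

Set Implicit Arguments.
Unset Strict Implicit.
Unset Printing Implicit Defensive.
Import Order.TTheory GRing.Theory Num.Theory.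
Local Open Scope ring_scope.

(** * Linear algebra modulo a subspace *)

Section LinearAlgebra.
Variables (k : fieldType) (M : lmodType k).
Implicit Types (N P : M -> Prop) (s e : seq M) (T : M -> M) (x y : M).

(** The usual route, finite length of holonomic D-modules, needs a module finitely generated over D.
    Here growth is only bounded for the larger algebra, and finite generation over D is itself to be
    proved. So chains are not bounded outright: what is excluded is [m] strict steps, for every [m],
    whose witnesses all lie in C^(K m) M_0 with [K] fixed, as each step adds m^n dimensions and
    m^(n+1) is too many. Every later argument is shaped by this: witnesses must come from finite
    data (fields of degree at most four, finitely many generators, one operator E) so that their
    depth grows linearly. Uncountability enters by counting: if all E - c were bijective on a
    nonzero finitely generated D-submodule, the vectors (E - c)^(-1) v would be uncountably many
    independent vectors in a space of countable dimension. This gives a [c] with E - c not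
    surjective, not an eigenvector, hence a chain of images in the last argument. *)

Definition subspace N := N 0 /\ forall (c : k) x y, N x -> N y -> N (c *: x + y).

Definition linop T := forall (c : k) x y, T (c *: x + y) = c *: T x + T y.

Lemma subspaceZ N c x : subspace N -> N x -> N (c *: x).
Proof. by move=> [N0 NL] Nx; rewrite -[_ *: _]addr0; apply: NL. Qed.

Lemma subspaceD N x y : subspace N -> N x -> N y -> N (x + y).
Proof. by move=> [_ NL] Nx Ny; rewrite -[x]scale1r; apply: NL. Qed.

Lemma subspaceN N x : subspace N -> N x -> N (- x).
Proof. by move=> NS Nx; rewrite -scaleN1r; apply: subspaceZ. Qed.

Lemma subspaceB N x y : subspace N -> N x -> N y -> N (x - y).
Proof. by move=> NS Nx Ny; apply: subspaceD => //; apply: subspaceN. Qed.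

Lemma subspace_sum N (I : Type) (r : seq I) (Q : pred I) (F : I -> M) :
  subspace N -> (forall i, Q i -> N (F i)) -> N (\sum_(i <- r | Q i) F i).
Proof.
move=> NS NF; apply: big_ind => //; first by case: NS.
by move=> x y; apply: subspaceD.
Qed.

Lemma subspace0 : subspace (fun x => x = 0).
Proof. by split=> // c x y -> ->; rewrite scaler0 addr0. Qed.

Lemma linop0 T : linop T -> T 0 = 0.
Proof. by move=> TL; have := TL (-1) 0 0; rewrite scaleN1r addNr scaleN1r addNr. Qed.

Lemma linopZ T c x : linop T -> T (c *: x) = c *: T x.
Proof. by move=> TL; rewrite -[c *: x]addr0 TL linop0 ?addr0. Qed.

Lemma linopD T x y : linop T -> T (x + y) = T x + T y.
Proof. by move=> TL; rewrite -[x]scale1r TL !scale1r. Qed.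

Lemma linopN T x : linop T -> T (- x) = - T x.
Proof. by move=> TL; rewrite -scaleN1r linopZ ?scaleN1r. Qed.

Lemma linopB T x y : linop T -> T (x - y) = T x - T y.
Proof. by move=> TL; rewrite linopD // linopN. Qed.

Lemma linop_sum T (I : Type) (r : seq I) (Q : pred I) (F : I -> M) : linop T ->
  T (\sum_(i <- r | Q i) F i) = \sum_(i <- r | Q i) T (F i).
Proof.
move=> TL; apply: (big_morph T); last exact: linop0.
by move=> x y; apply: linopD.
Qed.

Lemma linop_id : linop id.
Proof. by []. Qed.

Lemma linop_iter T j : linop T -> linop (iter j T).
Proof. by move=> TL; elim: j => // j IH c x y; rewrite !iterS IH TL. Qed.

Lemma subspace_preim N T : subspace N -> linop T -> subspace (fun x => N (T x)).
Proof.
move=> NS TL; split; first by rewrite linop0 //; case: NS.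
by move=> c x y Nx Ny; rewrite TL; case: NS => _; apply.
Qed.

Lemma linear_relation (I J : finType) (a : I -> J -> k) : (#|J| < #|I|)%N ->
  exists2 c : I -> k, (exists i, c i != 0) & forall j, \sum_i c i * a i j = 0.
Proof.
move=> ltJI.
pose A := \matrix_(i < #|I|, j < #|J|) a (enum_val i) (enum_val j).
have : kermx A != 0.
  rewrite kermx_eq0 /row_free; apply: contraTN ltJI => /eqP <-.
  by rewrite -leqNgt rank_leq_col.
move=> /matrix0Pn [r [i0 nz]].
exists (fun i => kermx A r (enum_rank i)).
  by exists (enum_val i0); rewrite enum_valK.
move=> j; have /matrixP /(_ r (enum_rank j)) := mulmx_ker A.
rewrite mxE [RHS]mxE => rel0; rewrite -[RHS]rel0 [RHS](reindex (@enum_rank I)) /=; last first.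
  exact: onW_bij (enum_rank_bij I).
by apply: eq_bigr => i _; rewrite [A _ _]mxE !enum_rankK.
Qed.

(** Coefficients are functions on [nat], so that no cast arises when the list is extended or
    split. *)
Definition spn s x := exists l : nat -> k, x = \sum_(i < size s) l i *: s`_i.

Lemma spn_sub N s x : subspace N -> (forall y, y \in s -> N y) -> spn s x -> N x.
Proof.
move=> NS Ns [l ->]; apply: subspace_sum => // i _.
by apply: subspaceZ => //; apply: Ns; rewrite mem_nth.
Qed.

Lemma spn_subspace s : subspace (spn s).
Proof.
split; first by exists (fun=> 0); rewrite big1 // => i _; rewrite scale0r.
move=> c x y [l ->] [l' ->]; exists (fun i => c * l i + l' i).
rewrite scaler_sumr -big_split /=; apply: eq_bigr => i _.
by rewrite scalerDl scalerA.
Qed.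

Lemma mem_spn s x : x \in s -> spn s x.
Proof.
move=> xs; exists (fun i => (i == index x s)%:R).
have lt : (index x s < size s)%N by rewrite index_mem.
rewrite (bigD1 (Ordinal lt)) //= eqxx scale1r nth_index // big1 ?addr0 // => i.
by rewrite -val_eqE /= => /negPf ->; rewrite scale0r.
Qed.

Definition indep_mod N e :=
  forall l : nat -> k, N (\sum_(i < size e) l i *: e`_i) ->
  forall i, (i < size e)%N -> l i = 0.

Definition spn_mod N e x := exists2 y, spn e y & N (x - y).

Lemma spn_mod_subspace N e : subspace N -> subspace (spn_mod N e).
Proof.
move=> NS; have eS := spn_subspace e; split.
  by exists 0; [case: eS | rewrite subr0; case: NS].
move=> c x x' [y ey Ny] [y' ey' Ny']; exists (c *: y + y').
  by case: eS => _; apply.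
suff -> : c *: x + x' - (c *: y + y') = c *: (x - y) + (x' - y').
  by case: NS => _; apply.
by rewrite opprD addrACA scalerBr.
Qed.

Lemma indep_mod_cons N e x : subspace N -> indep_mod N e -> ~ spn_mod N e x ->
  indep_mod N (x :: e).
Proof.
move=> NS ei nx l; rewrite /= big_ord_recl /=.
set w := (X in _ + X) => Nw.
have l0 : l 0%N = 0.
  apply: contrapT => /eqP nz; apply: nx.
  exists (- (l 0%N)^-1 *: w).
    by apply: subspaceZ; [exact: spn_subspace | exists (fun i => l i.+1)].
  rewrite scaleNr opprK -[x]scale1r -(mulVf nz) -scalerA -scalerDr.
  exact: subspaceZ.
move: Nw; rewrite l0 scale0r add0r => Nw [|i] //= lti.
exact: (ei (fun i => l i.+1) Nw).
Qed.

Lemma basis_mod N s : subspace N -> exists e,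
  [/\ subseq e s, indep_mod N e & forall x, x \in s -> spn_mod N e x].
Proof.
move=> NS; elim: s => [|x s [e [es ei se]]]; first by exists [::].
have [xe|xe] := pselect (spn_mod N e x).
  exists e; split=> // [|y]; first exact: subseq_trans es (subseq_cons _ _).
  by rewrite inE => /predU1P[->|/se].
exists (x :: e); split.
- by rewrite /= eqxx.
- exact: indep_mod_cons.
move=> y; rewrite inE => /predU1P[->|/se [z ez Nz]].
  by exists x; [apply: mem_spn; rewrite inE eqxx | rewrite subrr; case: NS].
exists z => //; apply: spn_sub ez; first exact: spn_subspace.
by move=> u ue; apply: mem_spn; rewrite inE ue orbT.
Qed.

Lemma indep_mod_le N e e' : subspace N -> indep_mod N e ->
  (forall x, x \in e -> spn_mod N e' x) -> (size e <= size e')%N.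
Proof.
move=> NS ei ee'; rewrite leqNgt; apply/negP => lt.
have /choice [a aP] : forall i : 'I_(size e), exists l : nat -> k,
    N (e`_i - \sum_(j < size e') l j *: e'`_j).
  by move=> i; have [_ [l ->] Nl] := ee' _ (mem_nth 0 (ltn_ord i)); exists l.
have [|c [i0 nz] rel] := @linear_relation 'I_(size e) 'I_(size e') (fun i j => a i j).
  by rewrite !card_ord.
move/eqP: nz; apply; pose l j := if insub j is Some i then c i else 0.
have lE (i : 'I_(size e)) : l i = c i by rewrite /l valK.
rewrite -lE; apply: ei => //.
suff -> : \sum_(i < size e) l i *: e`_i =
   \sum_(i < size e) c i *: (e`_i - \sum_(j < size e') a i j *: e'`_j).
  by apply: subspace_sum => // i _; apply: subspaceZ.
rewrite [RHS](eq_bigr (fun i : 'I__ => c i *: e`_i - \sum_(j < size e') (c i * a i j) *: e'`_j)).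
  rewrite sumrB exchange_big /= [X in _ - X]big1 ?subr0.
    by apply: eq_bigr => i _; rewrite lE.
  by move=> j _; rewrite -scaler_suml rel scale0r.
move=> i _; rewrite scalerBr scaler_sumr; congr (_ - _).
by apply: eq_bigr => j _; rewrite scalerA.
Qed.

(** Modulo the larger [N'] the part in [e'] disappears and leaves a relation on [e] alone. This is
    how the contributions of the steps of a chain add up. *)
Lemma indep_mod_cat N N' e e' : subspace N -> subspace N' ->
  (forall x, N x -> N' x) -> (forall x, x \in e' -> N' x) ->
  indep_mod N' e -> indep_mod N e' -> indep_mod N (e ++ e').
Proof.
move=> NS NS' NN' e'N' ei e'i l; rewrite size_cat big_split_ord /=.
rewrite (eq_bigr (fun i : 'I_(size e) => l i *: e`_i)); last first.
  by move=> i _; rewrite nth_cat ltn_ord.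
rewrite [X in _ + X](eq_bigr (fun i : 'I_(size e') => l (size e + i)%N *: e'`_i)); last first.
  by move=> i _; rewrite nth_cat ltnNge leq_addr /= addKn.
set a := (X in X + _); set b := (X in _ + X) => Nab.
have N'b : N' b.
  by apply: subspace_sum => // i _; apply: subspaceZ => //; apply: e'N'; rewrite mem_nth.
have l0 i : (i < size e)%N -> l i = 0.
  by apply: ei; rewrite -/a -(addrK b a); apply: subspaceB => //; apply: NN'.
have a0 : a = 0 by rewrite /a big1 // => i _; rewrite l0 ?scale0r.
move: Nab; rewrite a0 add0r => /(e'i (fun j => l (size e + j)%N)) lb i; have [lti _|lei] := ltnP
  i (size e).
  exact: l0.
by rewrite -{1 2}(subnKC lei) ltn_add2l; apply: lb.
Qed.

End LinearAlgebra.

(** * Bernstein's inequality *)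

Section Joseph.
Variables (k : fieldType) (M : lmodType k).
Hypothesis char0 : forall j : nat, j.+1%:R != 0 :> k.
Variables (N : M -> Prop) (g : nat -> seq M).
Hypothesis NS : subspace N.
Hypothesis g_mono : forall r x, spn (g r) x -> spn (g r.+1) x.

Definition raises (T : M -> M) := forall r x, spn (g r) x -> spn (g r.+1) (T x).
Definition stable (T : M -> M) := forall x, N x -> N (T x).

Lemma iter_canonical_comm (y z : M -> M) a x : linop z ->
  (forall x, y (z x) = z (y x) + x) ->
  y (iter a.+1 z x) = iter a.+1 z (y x) + a.+1%:R *: iter a z x.
Proof.
move=> zL yz; elim: a => [|a IH]; first by rewrite /= yz scale1r.
rewrite [iter a.+2 z x]iterS yz IH linopD // linopZ // -addrA; congr (_ + _).
by rewrite -iterS -[in RHS]natr1 scalerDl scale1r.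
Qed.

Lemma stable_iter T a : stable T -> stable (iter a T).
Proof. by move=> NT x Nx; elim: a => //= a; apply: NT. Qed.

Lemma spn_mono r r' x : (r <= r')%N -> spn (g r) x -> spn (g r') x.
Proof.
by move=> /subnK <-; elim: (r' - r)%N => //= j IH /IH; apply: g_mono.
Qed.

(* Taking the commutator with [y] differentiates the polynomial in [z], lowering the filtration
  by one. *)
Lemma coefficients_kill (y z : M -> M) (d : nat -> M -> M) s R :
  linop y -> linop z -> (forall x, y (z x) = z (y x) + x) ->
  stable y -> stable z -> raises y ->
  (forall a x, y (d a x) = d a (y x)) ->
  (forall x, spn (g (R + s)) x -> N (\sum_(a < s) iter a z (d a x))) ->
  forall a, (a < s)%N -> forall x, spn (g R) x -> N (d a x).
Proof.
move=> yL zL yz Ny Nz Fy; elim: s d => // s IH d yd Nd.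
have Nd1 a : (a < s)%N -> forall x, spn (g R) x -> N (d a.+1 x).
  move=> lt_as x Fx.
  have : N (a.+1%:R *: d a.+1 x).
    apply: (IH (fun a x => a.+1%:R *: d a.+1 x)) => // [b u|u Fu].
      by rewrite linopZ // yd.
    have Fyu : spn (g (R + s.+1)) (y u) by rewrite addnS; apply: Fy.
    have := subspaceB NS (Ny _ (Nd u _)) (Nd _ Fyu).
    rewrite addnS => /(_ (g_mono Fu)); rewrite linop_sum // -sumrB big_ord_recl /= yd subrr add0r.
    congr N; apply: eq_bigr => i _.
    rewrite -!iterS -yd iter_canonical_comm // addrC addKr linopZ //.
    exact: linop_iter.
  by move/(subspaceZ (a.+1%:R^-1) NS); rewrite scalerA mulVf // scale1r.
case=> [_|a lt_as]; last exact: Nd1.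
(* The coefficient of index 0 is invisible to the commutator; it is what remains after subtracting
   the others. *)
move=> x Fx; have := Nd x (spn_mono (leq_addr _ _) Fx).
rewrite big_ord_recl /= => Nsum.
rewrite -[d 0%N x](addrK (\sum_(i < s) z (iter i z (d i.+1 x)))).
apply: subspaceB => //; apply: subspace_sum => // i _.
exact: (@stable_iter z i.+1) (Nd1 _ _ _ _).
Qed.

(** A box of exponents below [b], not a bound on the total degree: the count is an exact power, and
    the variables can be removed one at a time. *)
Fixpoint monIdx (b m : nat) : finType :=
  if m is m'.+1 then ('I_b * monIdx b m')%type : finType else unit.

Lemma card_monIdx b m : #|monIdx b m| = (b ^ m)%N.
Proof.
by elim: m => [|m IH]; [rewrite card_unit | rewrite /= card_prod card_ord IH expnS].
Qed.

(** Only the second member of each pair enters the monomial; the first serves to differentiate with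
    respect to it. *)
Fixpoint mon b (ps : seq ((M -> M) * (M -> M))) : monIdx b (size ps) -> M -> M :=
  match ps with
  | [::] => fun _ => id
  | p :: ps' => fun t x => iter t.1 p.2 (mon t.2 x)
  end.

(** Triangular, to match the removal of one variable at a time. Nothing is asked of the second
    members among themselves, since in the application they are the [x_i] together with the
    [d_i]. *)
Fixpoint canonical_pairs (ps : seq ((M -> M) * (M -> M))) : Prop :=
  if ps is p :: ps' then
    [/\ [/\ linop p.1, stable p.1 & raises p.1],
        [/\ linop p.2, stable p.2 & raises p.2],
        forall x, p.1 (p.2 x) = p.2 (p.1 x) + x,
        forall q, q \in ps' -> forall x, p.1 (q.2 x) = q.2 (p.1 x)
      & canonical_pairs ps']
  else True.

Lemma mon_comm b ps (y : M -> M) (t : monIdx b (size ps)) x :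
  (forall q, q \in ps -> forall x, y (q.2 x) = q.2 (y x)) ->
  y (mon t x) = mon t (y x).
Proof.
elim: ps t => //= p ps IH [a t] /= yps.
rewrite -IH => [|q qps]; last by apply: yps; rewrite inE qps orbT.
elim: {+}(a : nat) => //= j <-.
by rewrite yps // inE eqxx.
Qed.

Lemma mon_linop b ps (t : monIdx b (size ps)) : canonical_pairs ps -> linop (mon t).
Proof.
elim: ps t => [|p ps IH] //= [a t] /= [_ [zL _ _] _ _ cps] c x y.
by rewrite IH // linop_iter.
Qed.

Lemma mon_stable b ps (t : monIdx b (size ps)) : canonical_pairs ps -> stable (mon t).
Proof.
elim: ps t => [|p ps IH] /=; first by move=> t _ x.
move=> [a t] /= [_ [_ zN _] _ _ cps] x Nx.
by apply: stable_iter => //; apply: IH.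
Qed.

Lemma mon_spn b ps (t : monIdx b (size ps)) r x : canonical_pairs ps ->
  spn (g r) x -> spn (g (b * size ps + r)) (mon t x).
Proof.
elim: ps t => [|p ps IH] t /=; first by rewrite muln0.
case: t => a t /= [_ [_ _ zF] _ _ cps] Fx.
apply: (@spn_mono (a + (b * size ps + r))).
  by rewrite mulnS -addnA leq_add2r ltnW.
by elim: {+}(a : nat) => [|j IHj] /=; [exact: IH | exact: zF].
Qed.

(** The operators multiplying the powers of [p.2] commute with [p.1], so [coefficients_kill] puts
    each of them into [N] on a filtration piece [b] steps lower. Once all pairs are used up, a
    scalar multiple of [v] lies in [N]. *)
Lemma monomials_independent b ps (c : monIdx b (size ps) -> k) v :
  spn (g 0%N) v -> ~ N v -> canonical_pairs ps ->
  (forall x, spn (g (b * size ps)) x -> N (\sum_t c t *: mon t x)) ->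
  forall t, c t = 0.
Proof.
move=> Fv Nv; elim: ps c => [|p ps IH] c /=.
  move=> _ Nc [] /=; apply: contrapT => /eqP nz; apply: Nv.
  have := Nc v; rewrite muln0 => /(_ Fv).
  rewrite (bigD1 tt) //= big1 ?addr0 => [|[]//].
  by move/(subspaceZ (c tt)^-1 NS); rewrite scalerA mulVf // scale1r.
case=> [[yL yN yF] [zL zN zF] yz yps cps] Nc [a0 t0].
pose d a x := if insub a is Some i then \sum_(t : monIdx b (size ps)) c (i, t) *: mon t x else 0.
have dE (i : 'I_b) x : d i x = \sum_(t : monIdx b (size ps)) c (i, t) *: mon t x.
  by rewrite /d valK.
apply: (IH (fun t => c (a0, t))) => // x Fx; rewrite -dE.
apply: (coefficients_kill (y := p.1) (z := p.2) (d := d) (s := b)) Fx => //.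
  move=> a u; rewrite /d; case: insubP => [i _ _|_]; last by rewrite linop0.
  rewrite linop_sum //; apply: eq_bigr => t _.
  by rewrite linopZ // mon_comm.
move=> u Fu; have := Nc u; rewrite mulnS addnC => /(_ Fu); congr N.
rewrite [RHS](eq_bigr (fun i : 'I_b => \sum_(t : monIdx b (size ps)) c (i, t) *: iter i p.2 (mon
  t u))); last first.
  move=> i _; rewrite dE linop_sum; last exact: linop_iter.
  by apply: eq_bigr => t _; rewrite linopZ //; exact: linop_iter.
by rewrite pair_big /=; apply: eq_bigr => -[i t] _.
Qed.

(* Joseph's proof of Bernstein's inequality: the [b ^ size ps] monomials embed into the linear
  maps from the [R]-th to the [2R]-th filtration piece modulo [N]. *)
Lemma bernstein_count b ps v : spn (g 0%N) v -> ~ N v -> canonical_pairs ps ->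
  let R := (b * size ps)%N in
  exists e, [/\ indep_mod N e, {subset e <= g (R + R)%N}
     & (b ^ size ps <= size e ^ 2)%N].
Proof.
move=> Fv Nv cps R.
have [e1 [/mem_subseq e1g e1i e1s]] := basis_mod (g R) NS.
have [e2 [/mem_subseq e2g e2i e2s]] := basis_mod (g (R + R)) NS.
have e2s' x : spn (g (R + R)) x -> spn_mod N e2 x.
  by apply: spn_sub => //; apply: spn_mod_subspace.
have le12 : (size e1 <= size e2)%N.
  apply: (indep_mod_le NS e1i) => x /e1g xg; apply: e2s'.
  by apply: (@spn_mono R); [exact: leq_addr | exact: mem_spn].
exists e2; split=> //; apply: (@leq_trans (size e1 * size e2)); last first.
  by rewrite -mulnn leq_mul2r le12 orbT.
rewrite leqNgt; apply/negP => lt.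
have /choice [a aP] : forall p : monIdx b (size ps) * 'I_(size e1), exists l : nat -> k,
    N (mon p.1 e1`_p.2 - \sum_(j < size e2) l j *: e2`_j).
  move=> [t i] /=; have [|_ [l ->] Nl] := e2s' (mon t e1`_i); last by exists l.
  by apply: mon_spn => //; apply: mem_spn; apply: e1g; rewrite mem_nth.
(* With more monomials than matrix entries, some combination has zero matrix on [e1] modulo [N]. *)
have [|c [t0 nz] rel] := @linear_relation k (monIdx b (size ps))
   ('I_(size e1) * 'I_(size e2))%type (fun t p => a (t, p.1) p.2).
  by rewrite card_monIdx card_prod !card_ord.
move/eqP: nz; apply; apply: (monomials_independent Fv Nv cps) => x.
have TL : linop (fun x => \sum_t c t *: mon t x).
  move=> d u w; rewrite scaler_sumr -big_split /=; apply: eq_bigr => t _.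
  by rewrite mon_linop // scalerDr !scalerA mulrC.
pose P x := N (\sum_t c t *: mon t x).
have SP : subspace P := subspace_preim NS TL.
rewrite -/(P x); apply: spn_sub => // u /e1s [w e1w Nuw].
rewrite -[u](subrK w) addrC; apply: (subspaceD SP); last first.
  by apply: subspace_sum => // t _; apply: subspaceZ => //; apply: mon_stable.
apply: (spn_sub SP) e1w => {Nuw w}w /(nthP 0) [i ltis <-].
rewrite /P; have -> : \sum_t c t *: mon t e1`_i = \sum_t c t *: (mon t e1`_i -
    \sum_(j < size e2) a (t, Ordinal ltis) j *: e2`_j).
  rewrite [RHS](eq_bigr (fun t => c t *: mon t e1`_i -
     \sum_(j < size e2) (c t * a (t, Ordinal ltis) j) *: e2`_j)); last first.
    move=> t _; rewrite scalerBr scaler_sumr; congr (_ - _).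
    by apply: eq_bigr => j _; rewrite scalerA.
  rewrite sumrB exchange_big /= [X in _ - X]big1 ?subr0 // => j _.
  by rewrite -scaler_suml (rel (Ordinal ltis, j)) scale0r.
by apply: subspace_sum => // t _; apply: subspaceZ => //; exact: (aP (t, Ordinal ltis)).
Qed.

End Joseph.

(** * Growth *)

Section Filtration.
Variables (k : closedFieldType) (M : lmodType k).
Implicit Types (cs : seq (M -> M)) (ms : seq M).

(** [dimspan] maximises over masks of [s], so the basis has to be extracted as a subsequence of
    [s]. *)
Lemma indep_mod0_le_dimspan (s e : seq M) : indep_mod (fun x => x = 0) e ->
  (forall x, x \in e -> spn s x) -> (size e <= dimspan s)%N.
Proof.
move=> ei es; have [e0 [/subseqP [b sb ->] e0i e0s]] := basis_mod s (subspace0 M).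
apply: (@leq_trans (size (mask b s))).
  apply: (indep_mod_le (subspace0 M) ei) => x /es.
  by apply: spn_sub => //; apply: spn_mod_subspace; apply: subspace0.
have bP : size b == size s by apply/eqP.
apply: (@leq_bigmax_cond _ _ (fun b : (size s).-tuple bool => size (mask b s)) (Tuple bP)).
apply/asboolP => l lsum i; pose l' j := if insub j is Some i then l i else 0.
have lE (j : 'I_(size (mask b s))) : l' j = l j by rewrite /l' valK.
rewrite -lE; apply: e0i => //; rewrite -[RHS]lsum.
by apply: eq_bigr => j _; rewrite lE.
Qed.

Lemma CmM0_0 cs ms : CmM0 cs ms 0 = ms.
Proof. by rewrite /CmM0 /= cats0 map_id. Qed.

Lemma mem_CmM0S cs ms m x : reflect (exists c y, [/\ c \in cs, y \in CmM0 cs ms m & x = c y])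
  (x \in CmM0 cs ms m.+1).
Proof.
apply: (iffP idP).
  move=> /allpairsP [[w y] /= [/allpairsP [[c w'] /= [ccs ww' ->]] yms ->]].
  by exists c, (w' y); split=> //; apply/allpairsP; exists (w', y).
move=> [c [_ [ccs /allpairsP [[w y] /= [ww yms ->]] ->]]].
apply/allpairsP; exists (c \o w, y); split=> //=.
by apply/allpairsP; exists (c, w).
Qed.

Lemma CmM0_mono cs ms r x : id \in cs -> spn (CmM0 cs ms r) x -> spn (CmM0 cs ms r.+1) x.
Proof.
move=> idcs; apply: spn_sub; first exact: spn_subspace.
by move=> y yr; apply: mem_spn; apply/mem_CmM0S; exists id, y.
Qed.

Lemma CmM0_raises cs ms c : linop c -> c \in cs -> raises (CmM0 cs ms) c.
Proof.
move=> cL ccs r x; apply: (@spn_sub _ _ (fun x => spn (CmM0 cs ms r.+1) (c x))).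
  exact: subspace_preim (spn_subspace _) cL.
by move=> y yr; apply: mem_spn; apply/mem_CmM0S; exists c, y.
Qed.

Lemma CmM0_ind cs ms (P : nat -> M -> Prop) :
  (forall r, subspace (P r)) -> (forall x, x \in ms -> P 0%N x) ->
  (forall c r x, c \in cs -> P r x -> P r.+1 (c x)) ->
  forall r x, spn (CmM0 cs ms r) x -> P r x.
Proof.
move=> PS P0 Pc r x; apply: spn_sub => // {x} y.
elim: r y => [y|r IH y]; first by rewrite CmM0_0; apply: P0.
by move=> /mem_CmM0S [c [z [ccs /IH Pz ->]]]; apply: Pc.
Qed.

End Filtration.

Section GrowthBound.
Local Open Scope classical_set_scope.

(** The limsup is tested along the multiples of [K]; the factor [K] is harmless because [ln (K * m)]
    is asymptotic to [ln m]. *)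
Lemma growth_lower_bound (k : closedFieldType) (M : lmodType k) (cs : seq (M -> M))
  (ms : seq M) (K n : nat) :
  (forall m, (0 < m)%N -> (m ^ n.+1 <= dimspan (CmM0 cs ms (K * m)))%N) ->
  ~ (growth cs ms <= (n%:R : Rdefinitions.R)%:E)%E.
Proof.
move=> lb leg.
(* An exponent strictly between [n] and [n + 1] whose double is an integer: after squaring, the
   inequality of logarithms becomes one of natural numbers. *)
pose q : Rdefinitions.R := n%:R + 2^-1.
have : (growth cs ms < q%:E)%E.
  by apply: le_lt_trans leg _; rewrite lte_fin ltrDl invr_gt0.
move=> /ereal_inf_lt [_ [V [r0 _ r0V] <-]] supV.
(* [r0] puts [K * m] into the tail, the offset 2 makes the logarithm positive, and m >= K^(2n+1)
   gives m^(2n+2) >= (K m)^(2n+1). *)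
pose m := (r0 + (K * 2) ^ (2 * n + 1)).+2.
have K0 : (0 < K)%N.
  rewrite lt0n; apply/negP => /eqP K0; have := lb (dimspan (CmM0 cs ms 0)).+2 isT.
  rewrite K0 mul0n expnS; apply/negP; rewrite -ltnNge.
  apply: leq_trans (leq_pmulr _ _); first exact: leqW.
  by rewrite expn_gt0.
have m0 : (1 < m)%N by [].
have : ((ln (dimspan (CmM0 cs ms (K * m)))%:R / ln ((K * m)%N%:R : Rdefinitions.R))%:E < q%:E)%E.
  apply: le_lt_trans supV; apply: ereal_sup_ubound; exists (K * m)%N => //.
  by apply: r0V; rewrite /= (leq_trans _ (leq_pmull _ K0)) // /m -addn2 -addnA leq_addr.
have Km1 : (1 < K * m)%N by rewrite (leq_trans m0) // leq_pmull.
have dpos : (0 < dimspan (CmM0 cs ms (K * m)))%N.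
  by apply: leq_trans (lb _ _) => //; rewrite expn_gt0.
rewrite lte_fin ltr_pdivrMr; last by rewrite ln_gt0 // ltr1n.
have e2 : q * 2 = (2 * n + 1)%N%:R.
  by rewrite /q mulrDl mulVf // natrD natrM mulrC.
rewrite -(ltr_pM2r (ltr0n _ 2)) mulrAC e2 mulr_natr mulr_natl -!lnXn ?ltr0n //; last first.
  exact: ltnW.
rewrite ltr_ln ?posrE ?exprn_gt0 ?ltr0n //; last exact: ltnW.
rewrite -!natrX ltr_nat; apply/negP; rewrite -leqNgt.
have : ((m ^ n.+1) ^ 2 <= dimspan (CmM0 cs ms (K * m)) ^ 2)%N by rewrite leq_exp2r // lb.
apply: leq_trans; rewrite -expnM (_ : n.+1 * 2 = (2 * n + 1).+1)%N; last first.
  by rewrite mulSn mulnC addn1.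
rewrite expnMn expnS leq_mul2r; apply/orP; right.
apply: (@leq_trans ((K * 2) ^ (2 * n + 1))).
  by rewrite leq_exp2r ?addn1 // leq_pmulr.
by rewrite /m -addnS -addnS; apply: leq_trans (leq_addl _ _); rewrite leqW.
Qed.

End GrowthBound.

(** * Polynomial vector fields *)

Lemma mpoly_ring_ind (k : nzRingType) (n : nat) (P : {mpoly k[n]} -> Prop) :
  (forall c, P c%:MP) -> (forall i, P 'X_i) ->
  (forall p q, P p -> P q -> P (p + q)) -> (forall p q, P p -> P q -> P (p * q)) ->
  forall p, P p.
Proof.
move=> PC PX PD PM p; rewrite [p]mpolyE.
apply: big_ind => [||m _]; [|exact: PD|]; first by rewrite -mpolyC0; apply: PC.
rewrite -mul_mpolyC; apply: (PM) => //; rewrite mpolyXE_id.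
apply: big_ind => [||i _]; [|exact: PM|]; first by rewrite -mpolyC1; apply: PC.
by elim: (m i) => [|j IH]; rewrite ?expr0 -?mpolyC1 // exprS; apply: PM.
Qed.

Section Derivations.
Variables (k : closedFieldType) (n : nat).
Local Notation A := {mpoly k[n]}.
Implicit Types (eta xi : Der k n) (f : A) (g h : 'I_n -> A).

Lemma Der_eq eta xi : proj1_sig eta =1 proj1_sig xi -> eta = xi.
Proof.
case: eta xi => [D dD] [D' dD'] /= /funext eD; subst D'.
by congr exist; apply: Prop_irrelevance.
Qed.

Lemma vf_isDer g : isDer (fun p : A => \sum_j g j * p^`M(j)).
Proof.
split=> [a p q|p q].
  rewrite scaler_sumr -big_split /=; apply: eq_bigr => j _.
  by rewrite mderivD mderivZ mulrDr scalerAr.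
rewrite mulr_suml mulr_sumr -big_split /=; apply: eq_bigr => j _.
by rewrite mderivM; ring.
Qed.

Definition vf g : Der k n := exist _ _ (vf_isDer g).

Definition mvf f (i : 'I_n) : Der k n := vf (fun j => if j == i then f else 0).

Definition pd i := mvf 1 i.

Lemma vfE g p : proj1_sig (vf g) p = \sum_j g j * p^`M(j).
Proof. by []. Qed.

Lemma mvfE f i p : proj1_sig (mvf f i) p = f * p^`M(i).
Proof.
rewrite vfE (bigD1 i) //= eqxx big1 ?addr0 // => j /negPf ->.
by rewrite mul0r.
Qed.

Lemma pdE i p : proj1_sig (pd i) p = p^`M(i).
Proof. by rewrite mvfE mul1r. Qed.

Lemma der_lin eta (c : k) p q :
  proj1_sig eta (c *: p + q) = c *: proj1_sig eta p + proj1_sig eta q.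
Proof. by case: eta => D [DL DM]. Qed.

Lemma derM eta p q :
  proj1_sig eta (p * q) = proj1_sig eta p * q + p * proj1_sig eta q.
Proof. by case: eta => D [DL DM]. Qed.

Lemma derD eta p q : proj1_sig eta (p + q) = proj1_sig eta p + proj1_sig eta q.
Proof. by have := der_lin eta 1 p q; rewrite !scale1r. Qed.

Lemma der0 eta : proj1_sig eta 0 = 0.
Proof. by have := derD eta 0 0; rewrite addr0 => /esym/eqP; rewrite -subr_eq0 addrK => /eqP. Qed.

Lemma derZ eta c p : proj1_sig eta (c *: p) = c *: proj1_sig eta p.
Proof. by rewrite -[c *: p]addr0 der_lin der0 addr0. Qed.

Lemma derC eta (c : k) : proj1_sig eta c%:MP = 0.
Proof.
rewrite -alg_mpolyC derZ; suff -> : proj1_sig eta 1 = 0 by rewrite scaler0.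
have := derM eta 1 1; rewrite !mulr1 mul1r => /esym/eqP.
by rewrite -subr_eq0 addrK => /eqP.
Qed.

Lemma der_eq_on_vars eta xi :
  (forall i, proj1_sig eta 'X_i = proj1_sig xi 'X_i) -> eta = xi.
Proof.
move=> eX; apply: Der_eq; apply: mpoly_ring_ind => [c|//|p q ep eq|p q ep eq].
- by rewrite !derC.
- by rewrite !derD ep eq.
- by rewrite !derM ep eq.
Qed.

Lemma mderivXi i j : ('X_i : A)^`M(j) = (i == j)%:R.
Proof.
rewrite mderivX mnm1E; case: eqVneq => [->|_]; last by rewrite scale0r.
by rewrite scale1r -[X in (X - _)%MM]add0m addmK mpolyX0.
Qed.

Lemma vf_eta eta : eta = vf (fun i => proj1_sig eta 'X_i).
Proof.
apply: der_eq_on_vars => i; rewrite vfE (bigD1 i) //= mderivXi eqxx mulr1.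
rewrite big1 ?addr0 // => j; rewrite mderivXi eq_sym => /negPf ->.
by rewrite mulr0.
Qed.

Lemma mvf_lin c f f' i p : proj1_sig (mvf (c *: f + f') i) p =
  c *: proj1_sig (mvf f i) p + proj1_sig (mvf f' i) p.
Proof. by rewrite !mvfE mulrDl scalerAl. Qed.

Lemma derScaleE f eta p : proj1_sig (derScale f eta) p = f * proj1_sig eta p.
Proof. by []. Qed.

Lemma derScale_mvf f f' i : derScale f (mvf f' i) = mvf (f * f') i.
Proof. by apply: Der_eq => p; rewrite derScaleE !mvfE mulrA. Qed.

Lemma derScaleA f f' eta : derScale f (derScale f' eta) = derScale (f * f') eta.
Proof. by apply: Der_eq => p; rewrite !derScaleE mulrA. Qed.

Lemma der_bracket_isDer eta xi : isDer (fun p =>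
  proj1_sig eta (proj1_sig xi p) - proj1_sig xi (proj1_sig eta p)).
Proof.
split=> [a p q|p q].
  by rewrite !der_lin opprD addrACA scalerBr.
rewrite !derM !derD !derM.
ring.
Qed.

Definition der_bracket eta xi : Der k n := exist _ _ (der_bracket_isDer eta xi).

Lemma der_bracketE eta xi p : proj1_sig (der_bracket eta xi) p =
  proj1_sig eta (proj1_sig xi p) - proj1_sig xi (proj1_sig eta p).
Proof. by []. Qed.

Lemma bracket_mvf f i f' j p : proj1_sig (der_bracket (mvf f i) (mvf f' j)) p =
  f * f'^`M(i) * p^`M(j) - f' * f^`M(j) * p^`M(i).
Proof. by rewrite der_bracketE !mvfE !mderivM [p^`M(i)^`M(j)]mderiv_comm; ring. Qed.

Lemma der_comb_isDer (c : k) eta xi :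
  isDer (fun p => c *: proj1_sig eta p + proj1_sig xi p).
Proof.
split=> [a p q|p q].
  rewrite !der_lin !scalerDr !scalerA addrACA [c * a]mulrC.
  by congr (_ + _).
by rewrite !derM -!mul_mpolyC; ring.
Qed.

Definition der_comb c eta xi : Der k n := exist _ _ (der_comb_isDer c eta xi).

Lemma der_combE c eta xi p :
  proj1_sig (der_comb c eta xi) p = c *: proj1_sig eta p + proj1_sig xi p.
Proof. by []. Qed.

(** A derivation is determined by its values on the variables, hence is a finite combination of
    fields x^m d_i. *)
Lemma der_ind (P : Der k n -> Prop) :
  (forall eta, proj1_sig eta =1 (fun=> 0) -> P eta) ->
  (forall c eta xi, P eta -> P xi -> P (der_comb c eta xi)) ->
  (forall m i, P (mvf 'X_[m] i)) -> forall eta, P eta.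
Proof.
move=> P0 PD PX.
have Pmvf f i : P (mvf f i).
  elim/mpolyind: f => [|c m p _ _ Pp].
    by apply: P0 => p; rewrite mvfE mul0r.
  suff -> : mvf (c *: 'X_[m] + p) i = der_comb c (mvf 'X_[m] i) (mvf p i) by apply: PD.
  by apply: Der_eq => q; rewrite mvf_lin.
move=> eta; rewrite [eta]vf_eta; set g := fun i => _.
suff [zeta Pz zE] : exists2 zeta, P zeta & forall p, proj1_sig zeta p = \sum_i g i * p^`M(i).
  by rewrite (_ : vf g = zeta) //; apply: Der_eq => p; rewrite zE.
elim: (index_enum 'I_n) => [|i r [zeta Pz zE]].
  by exists (vf (fun=> 0)) => [|p]; rewrite ?big_nil ?vfE ?big1 //;
    [apply: P0 => p; rewrite vfE big1 // => j|move=> j]; rewrite mul0r.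
exists (der_comb 1 (mvf (g i) i) zeta); first exact: PD.
by move=> p; rewrite der_combE scale1r zE big_cons mvfE.
Qed.

End Derivations.

(** * Chains of D-submodules *)

Section AVModule.
Variables (k : closedFieldType) (n : nat) (M : lmodType k).
Hypothesis hchar : [pchar k] =i pred0.
Variables (actA : {mpoly k[n]} -> M -> M) (rho : Der k n -> M -> M).
Hypothesis hAV : isAVmodule actA rho.
Implicit Types (f : {mpoly k[n]}) (eta xi : Der k n) (cs : seq (M -> M)) (ms : seq M).

Local Notation x_ i := (actA 'X_i).
Local Notation d_ i := (rho (pd k i)).

Lemma char0_neq0 j : j.+1%:R != 0 :> k.
Proof. by move/pcharf0P: hchar => ->. Qed.

Lemma actAC c m : actA c%:MP m = c *: m.
Proof. exact: actA_const hAV c m. Qed.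

Lemma actAM f f' m : actA (f * f') m = actA f (actA f' m).
Proof. exact: actA_mul hAV f f' m. Qed.

Lemma actAZ c f m : actA (c *: f) m = c *: actA f m.
Proof. by rewrite -mul_mpolyC actAM actAC. Qed.

Lemma actAD f f' m : actA (f + f') m = actA f m + actA f' m.
Proof. exact: actA_addl hAV f f' m. Qed.

Lemma actA0 m : actA 0 m = 0.
Proof. by rewrite -mpolyC0 actAC scale0r. Qed.

Lemma actA1 m : actA 1 m = m.
Proof. by rewrite -mpolyC1 actAC scale1r. Qed.

Lemma actA_linop f : linop (actA f).
Proof.
move=> c m m'; rewrite (actA_addr hAV) -!actAC -!actAM.
by rewrite mulrC.
Qed.

Lemma actA_comm f f' m : actA f (actA f' m) = actA f' (actA f m).
Proof. by rewrite -!actAM mulrC. Qed.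

Lemma rho_linop eta : linop (rho eta).
Proof. by move=> c m m'; rewrite (rho_lin hAV). Qed.

Lemma rho_actA eta f m : rho eta (actA f m) = actA (proj1_sig eta f) m + actA f (rho eta m).
Proof. exact: rho_leibniz hAV eta f m. Qed.

Lemma rho_comb c eta xi m : rho (der_comb c eta xi) m = c *: rho eta m + rho xi m.
Proof. exact: (rho_klin hAV). Qed.

Lemma rho0 eta m : proj1_sig eta =1 (fun=> 0) -> rho eta m = 0.
Proof.
move=> e0; rewrite (rho_klin hAV (c := -1) (eta := eta) (xi := eta)) ?scaleN1r ?addNr //.
by move=> p; rewrite e0 addr0 scaler0.
Qed.

Lemma rho_brk eta xi m :
  rho (der_bracket eta xi) m = rho eta (rho xi m) - rho xi (rho eta m).
Proof. exact: (rho_bracket hAV). Qed.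

Lemma d_comm i j m : d_ i (d_ j m) = d_ j (d_ i m).
Proof.
apply/eqP; rewrite -subr_eq0 -rho_brk rho0 // => p.
by rewrite der_bracketE !pdE mderiv_comm subrr.
Qed.

Lemma d_x i j m : d_ i (x_ j m) = x_ j (d_ i m) + (i == j)%:R *: m.
Proof.
rewrite rho_actA pdE mderivXi addrC eq_sym; congr (_ + _).
by case: eqP => _; rewrite ?actA1 ?actA0 ?scale1r ?scale0r.
Qed.

Definition dsub (N : M -> Prop) :=
  [/\ subspace N, forall i, stable N (x_ i) & forall i, stable N (d_ i)].

(** The identity is a member so that the pieces [CmM0] increase. *)
Definition weyl_gens : seq (M -> M) :=
  id :: [seq x_ i | i <- enum 'I_n] ++ [seq d_ i | i <- enum 'I_n].

Lemma weyl_gensP T : T \in weyl_gens -> [\/ T = id, exists i, T = x_ i | exists i, T = d_ i].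
Proof.
rewrite inE mem_cat => /or3P[/eqP ->|/mapP[i _ ->]|/mapP[i _ ->]].
- exact: Or31.
- by apply: Or32; exists i.
- by apply: Or33; exists i.
Qed.

Lemma mem_weyl_x i : x_ i \in weyl_gens.
Proof. by rewrite inE mem_cat (map_f (fun i => x_ i)) ?orbT // mem_enum. Qed.

Lemma mem_weyl_d i : d_ i \in weyl_gens.
Proof. by rewrite inE mem_cat (map_f (fun i => d_ i)) ?orbT // mem_enum. Qed.

Lemma weyl_linop T : T \in weyl_gens -> linop T.
Proof.
case/weyl_gensP => [->|[i ->]|[i ->]]; [exact: linop_id|exact: actA_linop|exact: rho_linop].
Qed.

Lemma weyl_stable N T : dsub N -> T \in weyl_gens -> stable N T.
Proof. by move=> [_ Nx Nd] /weyl_gensP[->|[i ->]|[i ->]]. Qed.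

(** Since [d_i, x_i] = [-x_i, d_i] = 1, each of the 2n generators of the Weyl algebra occurs as a
    variable, with the other one of the same index, up to sign, to differentiate it. *)
Definition weyl_pairs : seq ((M -> M) * (M -> M)) :=
  [seq (d_ i, x_ i) | i <- enum 'I_n] ++ [seq ((fun m => - x_ i m), d_ i) | i <- enum 'I_n].

Lemma size_weyl_pairs : size weyl_pairs = (n + n)%N.
Proof. by rewrite size_cat !size_map -enumT size_enum_ord. Qed.

Lemma weyl_pairs_canonical N ms : dsub N ->
  canonical_pairs N (CmM0 weyl_gens ms) weyl_pairs.
Proof.
move=> [NS Nx Nd].
have Rx i : raises (CmM0 weyl_gens ms) (x_ i).
  by apply: CmM0_raises; [exact: actA_linop | exact: mem_weyl_x].
have Rd i : raises (CmM0 weyl_gens ms) (d_ i).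
  by apply: CmM0_raises; [exact: rho_linop | exact: mem_weyl_d].
have cp_neg s : uniq s -> canonical_pairs N (CmM0 weyl_gens ms)
    [seq ((fun m => - x_ i m), d_ i) | i <- s].
  elim: s => [//|i s IH] /= /andP[is_ us].
  split; last exact: IH.
  - split=> /=.
    + by move=> c u v; rewrite actA_linop scalerN opprD.
    + by move=> u Nu; apply: subspaceN => //; apply: Nx.
    + by move=> r u Fu; apply: subspaceN; [exact: spn_subspace | exact: Rx].
  - by split; [exact: rho_linop | exact: Nd | exact: Rd].
  - move=> u /=; rewrite linopN ?d_x; last exact: rho_linop.
    by rewrite eqxx scale1r opprD addrNK.
  - move=> q /mapP [j js ->] u /=; rewrite linopN ?d_x; last exact: rho_linop.
    case: eqP => [ji|_]; last by rewrite scale0r addr0.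
    by move: is_; rewrite -ji js.
suff cp_pos s : uniq s -> canonical_pairs N (CmM0 weyl_gens ms)
    ([seq (d_ i, x_ i) | i <- s] ++ [seq ((fun m => - x_ i m), d_ i) | i <- enum 'I_n]).
  exact: cp_pos (enum_uniq 'I_n).
elim: s => [_|i s IH]; first exact: cp_neg (enum_uniq 'I_n).
move=> /= /andP[is_ us]; split; last exact: IH.
- by split; [exact: rho_linop | exact: Nd | exact: Rd].
- by split; [exact: actA_linop | exact: Nx | exact: Rx].
- by move=> u /=; rewrite d_x eqxx scale1r.
- move=> q; rewrite mem_cat => /orP[] /mapP [j js ->] u /=; last exact: d_comm.
  rewrite d_x; case: eqP => [ij|_]; last by rewrite scale0r addr0.
  by move: is_; rewrite ij js.
Qed.

Lemma weyl_spn_dsub N v r : dsub N -> N v ->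
  forall x, spn (CmM0 weyl_gens [:: v] r) x -> N x.
Proof.
move=> dN Nv x; apply: (CmM0_ind (P := fun _ => N)) => [_|y|c _ y cw Ny].
- by case: dN.
- by rewrite inE => /eqP ->.
- exact: (weyl_stable dN cw).
Qed.

(** There are [n + n] pairs, so the depth is twice [m * (n + n)], and the square root of m^(2n) is
    the bound. *)
Lemma weyl_bernstein N v m : dsub N -> ~ N v ->
  exists e, [/\ indep_mod N e, {subset e <= CmM0 weyl_gens [:: v] (4 * n * m)}
     & (m ^ n <= size e)%N].
Proof.
move=> dN Nv; have NS : subspace N by case: dN.
have idw : id \in weyl_gens by rewrite inE eqxx.
have Fv : spn (CmM0 weyl_gens [:: v] 0) v by apply: mem_spn; rewrite CmM0_0 inE.
have [e [ei es le]] := bernstein_count char0_neq0 NS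
  (fun r y => @CmM0_mono _ _ _ [:: v] r y idw) m Fv Nv (weyl_pairs_canonical [:: v] dN).
exists e; split=> //.
  by move: es; rewrite size_weyl_pairs (_ : (m * _ + _)%N = (4 * n * m)%N) //; lia.
by move: le; rewrite size_weyl_pairs addnn -muln2 expnM leq_exp2r.
Qed.

Lemma spn_extend cs ms s v : id \in cs -> {subset weyl_gens <= cs} ->
  spn (CmM0 cs ms s) v ->
  forall r y, spn (CmM0 weyl_gens [:: v] r) y -> spn (CmM0 cs ms (s + r)) y.
Proof.
move=> idcs sub Fv r y.
apply: (CmM0_ind (P := fun r y => spn (CmM0 cs ms (s + r)) y)) => [r'|z|c r' z cw Fz].
- exact: spn_subspace.
- by rewrite inE addn0 => /eqP ->.
- by rewrite addnS; apply: CmM0_raises => //; [exact: weyl_linop | exact: sub].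
Qed.

Lemma spn_CmM0_mono cs ms r r' y : id \in cs -> (r <= r')%N ->
  spn (CmM0 cs ms r) y -> spn (CmM0 cs ms r') y.
Proof. by move=> idcs; apply: spn_mono => {}r {}y; apply: CmM0_mono. Qed.

Lemma mem_op_in_span cs (T : M -> M) : T \in cs -> op_in_span cs T.
Proof.
move=> Tcs; have lt : (index T cs < size cs)%N by rewrite index_mem.
exists (fun i => (i == Ordinal lt)%:R) => m.
rewrite (bigD1 (Ordinal lt)) //= eqxx scale1r nth_index // big1 ?addr0 // => i.
by move=> /negPf ->; rewrite scale0r.
Qed.

Hypothesis hGK : GKdim actA rho = (n%:R : Rdefinitions.R)%:E.

(* Each [v i] contributes at least [m ^ n] dimensions, by Bernstein's inequality in [D v_i]
  modulo [N i], so [C^(K' m) M0] has dimension at least [m ^ (n + 1)]. *)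
Lemma no_long_chains cs ms K :
  (forall c, c \in cs -> Bop actA rho c) -> {subset weyl_gens <= cs} ->
  ~ (forall m, (0 < m)%N -> exists (N : nat -> M -> Prop) (v : nat -> M),
      [/\ forall j, (j < m)%N -> dsub (N j),
          forall i, (i < m)%N -> spn (CmM0 cs ms (K * m)) (v i) /\ ~ N i (v i)
        & forall i j, (i < j < m)%N -> N j (v i)]).
Proof.
move=> csB sub ch.
have idcs : id \in cs by apply: sub; rewrite inE eqxx.
apply: (@growth_lower_bound k M cs ms (K + 4 * n) n); last first.
  rewrite -hGK; apply: ereal_sup_ubound; exists cs; last by exists ms.
  by split=> //; apply: mem_op_in_span.
move=> m m0; have [N [v [dN vN vNj]]] := ch m m0.
suff [e [ei es le]] : exists e, [/\ indep_mod (fun x => x = 0) e,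
    forall y, y \in e -> spn (CmM0 cs ms ((K + 4 * n) * m)) y & (m * m ^ n <= size e)%N].
  by rewrite expnS; apply: leq_trans le _; apply: indep_mod0_le_dimspan.
(* Invariant: the vectors collected so far lie in every later [N j']. Those added at step [j] are
   independent modulo [N j], hence independent of the earlier ones. *)
suff : forall j, (j <= m)%N -> exists e, [/\ indep_mod (fun x => x = 0) e,
    forall y, y \in e -> spn (CmM0 cs ms ((K + 4 * n) * m)) y, (j * m ^ n <= size e)%N
    & forall y j', y \in e -> (j <= j' < m)%N -> N j' y].
  by move=> /(_ m (leqnn m)) [e [? ? ? _]]; exists e.
elim=> [_|j IH lt_jm]; first by exists [::]; split=> // l _ i.
have [e [ei es le eN]] := IH (ltnW lt_jm).
have [Fv Nv] := vN j lt_jm.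
have [e' [e'i e's le']] := weyl_bernstein m (dN j lt_jm) Nv.
have [NS _ _] := dN j lt_jm.
exists (e' ++ e); split.
- apply: (indep_mod_cat (subspace0 M) NS _ _ e'i ei) => [y ->|y ye]; first by case: NS.
  by apply: eN; rewrite // leqnn.
- move=> y; rewrite mem_cat => /orP[/e's ye|/es //].
  by rewrite mulnDl; apply: (spn_extend idcs sub Fv); apply: mem_spn.
- by rewrite size_cat mulSn leq_add.
- move=> y j'; rewrite mem_cat => /orP[/e's ye|ye] /andP[jj' j'm]; last first.
    by apply: eN; rewrite // (ltnW jj').
  apply: (weyl_spn_dsub (dN j' j'm) _ (mem_spn ye)).
  by apply: vNj; rewrite jj'.
Qed.

End AVModule.

(** * Finite generation over D *)

Section FiniteGeneration.
Variables (k : closedFieldType) (n : nat) (M : lmodType k).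
Hypothesis hchar : [pchar k] =i pred0.
Variables (actA : {mpoly k[n]} -> M -> M) (rho : Der k n -> M -> M).
Hypothesis hAV : isAVmodule actA rho.

Local Notation x_ i := (actA 'X_i).
Local Notation d_ i := (rho (pd k i)).

Lemma mulX_mderiv (m : 'X_{1..n}) j :
  'X_j * ('X_[m])^`M(j) = (m j)%:R *: 'X_[m] :> {mpoly k[n]}.
Proof.
rewrite mderivX -scalerAr -mpolyXD; case E : (m j) => [|c]; first by rewrite !scale0r.
by rewrite addmC submK //; apply/mnm_lepP => l; rewrite mnm1E; case: eqP => // <-; rewrite E.
Qed.

Lemma dsub_actA N f : dsub actA rho N -> stable N (actA f).
Proof.
move=> [NS Nx _]; elim/mpoly_ring_ind: f => [c|//|p q Np Nq|p q Np Nq] u Nu.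
- by rewrite (actAC hAV); apply: subspaceZ.
- by rewrite (actAD hAV); apply: subspaceD; [|apply: Np|apply: Nq].
- by rewrite (actAM hAV); apply: Np; apply: Nq.
Qed.

(** The generated D-submodule as an intersection, so that membership is an induction principle. *)
Definition dgen (P : M -> Prop) u := forall N, dsub actA rho N -> (forall y, P y -> N y) -> N u.

Lemma dgen_incl (P : M -> Prop) u : P u -> dgen P u.
Proof. by move=> Pu N _; apply. Qed.

Lemma dgen_dsub P : dsub actA rho (dgen P).
Proof.
split=> [|i u Du N dN PN|i u Du N dN PN].
- split=> [N [NS _ _] _|c u v Du Dv N dN PN]; first by case: NS.
  have [[_ NL] _ _] := dN; apply: NL; [exact: Du | exact: Dv].
- by have [_ Nx _] := dN; apply: Nx; apply: Du.
- by have [_ _ Nd] := dN; apply: Nd; apply: Du.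
Qed.

Lemma rho_mvfZ c f i u : rho (mvf (c *: f) i) u = c *: rho (mvf f i) u.
Proof.
rewrite (rho_klin hAV (c := c) (eta := mvf f i) (xi := mvf 0 i)).
  by rewrite [rho (mvf 0 i) u](rho0 hAV) ?addr0 // => p; rewrite mvfE mul0r.
by move=> p; rewrite -mvf_lin addr0.
Qed.

(** The displayed identity is [f d_i, f' d_j] = c g d_l evaluated at [p]; dividing by [c] recovers g
    d_l. *)
Lemma stable_bracket N c f i f' j g l : subspace N -> c != 0 ->
  (forall p : {mpoly k[n]}, f * f'^`M(i) * p^`M(j) - f' * f^`M(j) * p^`M(i) = c *: (g * p^`M(l))) ->
  stable N (rho (mvf f i)) -> stable N (rho (mvf f' j)) -> stable N (rho (mvf g l)).
Proof.
move=> NS c0 E Ni Nj u Nu.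
have -> : rho (mvf g l) u = c^-1 *: rho (mvf (c *: g) l) u.
  by rewrite rho_mvfZ scalerA mulVf // scale1r.
apply: subspaceZ => //; rewrite (_ : mvf _ _ = der_bracket (mvf f i) (mvf f' j)).
  by rewrite (rho_brk hAV); apply: subspaceB => //; [apply/Ni/Nj | apply/Nj/Ni].
by apply: Der_eq => p; rewrite bracket_mvf E mvfE scalerAl.
Qed.

(* [x_l x_j d_j, x^b d_i] = b_j x_l x^b d_i for l, j != i, and [x_i^2 d_i, x^b d_i] = (b_i - 2)
  x_i x^b d_i, so degrees at most four generate. *)
Lemma stable_rho N : subspace N ->
  (forall (m : 'X_{1..n}) i, (mdeg m < 5)%N -> stable N (rho (mvf 'X_[m] i))) ->
  forall eta, stable N (rho eta).
Proof.
move=> NS N5; have NX : forall (m : 'X_{1..n}) i, stable N (rho (mvf 'X_[m] i)).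
  move=> m; have [d] := ubnP (mdeg m); elim: d m => // d IH m lt i.
  have [lt5|ge5] := ltnP (mdeg m) 5; first exact: N5.
  have Xsub l : (0 < m l)%N -> 'X_l * 'X_[m - U_(l)] = 'X_[m] :> {mpoly k[n]}.
    move=> ml; rewrite -mpolyXD addmC submK //.
    by apply/mnm_lepP => l'; rewrite mnm1E; case: eqP => // <-.
  have dsubl l : (0 < m l)%N -> mdeg m = (mdeg (m - U_(l))%MM).+1.
    move=> ml; rewrite -[in LHS](@submK _ U_(l) m).
      by rewrite mdegD mdeg1 addn1.
    by apply/mnm_lepP => l'; rewrite mnm1E; case: eqP => // <-.
  (* In degree at least five, either [m i] is at least 4 and b_i - 2 = m_i - 3 is nonzero, or two
     units of degree lie outside [i], possibly on the same variable, and serve as x_l x_j. *)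
  have [mi|mi] := ltnP 3 (m i).
    have mi0 : (0 < m i)%N by apply: leq_trans mi.
    have c0 : ((m i).-1 - 2)%N%:R != 0 :> k.
      by case: (m i) mi => [|[|[|[|c]]]] // _; rewrite (char0_neq0 hchar).
    apply: (stable_bracket (i := i) (j := i) (f := 'X_[U_(i) + U_(i)])
       (f' := 'X_[m - U_(i)]) NS c0).
    - move=> p; rewrite -[in RHS](Xsub i mi0).
      have := mulX_mderiv (m - U_(i))%MM i; rewrite mnmBE mnm1E eqxx subn1.
      set Y := 'X_[m - U_(i)]; set Z := Y^`M(i); set q := p^`M(i) => E.
      rewrite natrB; last by rewrite -ltnS prednK // ltnW.
      rewrite scaler_nat in E; rewrite scalerBl !scaler_nat.
      have -> : ('X_i * Y * q) *+ (m i).-1 = 'X_i * ('X_i * Z) * q.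
        by rewrite E mulrnAr mulrnAl.
      by rewrite mpolyXD mderivM !mderivXi eqxx /=; ring.
    - by apply: N5; rewrite mdegD mdeg1.
    - by apply: IH; rewrite -ltnS -dsubl.
  have [l li ml] : exists2 l, l != i & (0 < m l)%N.
    apply: contrapT => no; suff : (mdeg m <= 3)%N by move/(leq_trans ge5).
    rewrite mdegE (bigD1 i) //= big1 ?addn0 // => l li.
    by apply/eqP; rewrite -leqn0 leqNgt; apply/negP => ml; apply: no; exists l.
  have [j ji mj] : exists2 j, j != i & (0 < (m - U_(l))%MM j)%N.
    apply: contrapT => no; suff : (mdeg (m - U_(l))%MM <= 3)%N.
      by move=> le; move: ge5; rewrite (dsubl l ml) ltnS leqNgt ltnS le.
    rewrite mdegE (bigD1 i) //= big1 ?addn0 => [|j ji].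
      by rewrite mnmBE (leq_trans (leq_subr _ _)).
    by apply/eqP; rewrite -leqn0 leqNgt; apply/negP => mj; apply: no; exists j.
  have c0 : ((m - U_(l))%MM j)%:R != 0 :> k.
    by case: (_ j) mj => // c _; rewrite (char0_neq0 hchar).
  apply: (stable_bracket (i := j) (j := i) (f := 'X_[U_(l) + U_(j)])
       (f' := 'X_[m - U_(l)]) NS c0).
  - move=> p; rewrite mpolyXD mderivM !mderivXi (negPf li) (negPf ji) mul0r mulr0 addr0 mulr0
    mul0r subr0.
    by rewrite -[_ * _ * _^`M(j)]mulrA mulX_mderiv -(Xsub l ml) -scalerAr -scalerAl.
  - by apply: N5; rewrite mdegD !mdeg1.
  - by apply: IH; rewrite -ltnS -dsubl.
apply: der_ind => [eta e0 u _|c eta xi Ne Nx u Nu|//].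
  by rewrite (rho0 hAV) //; case: NS.
rewrite (rho_comb hAV); apply: subspaceD => //; last exact: Nx.
by apply: subspaceZ => //; apply: Ne.
Qed.

(** Growth is measured with finitely many operators; by [stable_rho] these control all vector
    fields. *)
Definition low_gens : seq (M -> M) := weyl_gens actA rho ++
  [seq rho (mvf 'X_[bmnm m] i) | m <- enum {: 'X_{1..n < 5}}, i <- enum 'I_n].

Lemma mem_low_gens (m : 'X_{1..n}) i : (mdeg m < 5)%N -> rho (mvf 'X_[m] i) \in low_gens.
Proof.
move=> lt; rewrite mem_cat; apply/orP; right; apply/allpairsP.
by exists (BMultinom lt, i); rewrite /= !mem_enum.
Qed.

Lemma low_gens_Bop c : c \in low_gens -> Bop actA rho c.
Proof.
rewrite mem_cat => /orP[/weyl_gensP[->|[i ->]|[i ->]]|/allpairsP[[m i] /= [_ _ ->]]].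
- exact: Bop_id.
- exact: Bop_A.
- exact: Bop_V.
- exact: Bop_V.
Qed.

Hypothesis hGK : GKdim actA rho = (n%:R : Rdefinitions.R)%:E.

(** Let N_j be the D-submodule generated by the [j]-th piece. If no N_j contained the next piece,
    witnesses would appear one per filtration step. So some N_j does; it is then stable under the
    low fields, hence under all fields, hence is all of [M]. *)
Lemma weyl_finitely_generated : fin_gen actA rho ->
  exists V : seq M, forall u, dgen (fun y => y \in V) u.
Proof.
move=> [gens gensP].
pose N j := dgen (spn (CmM0 low_gens gens j)).
have idl : id \in low_gens by rewrite mem_cat inE eqxx.
have sub : {subset weyl_gens actA rho <= low_gens}.
  by move=> T wT; rewrite mem_cat wT.
have [j jP] : exists j, forall u, spn (CmM0 low_gens gens j.+1) u -> N j u.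
  apply: contrapT => no.
  have /choice [v vP] : forall j, exists v, spn (CmM0 low_gens gens j.+1) v /\ ~ N j v.
    move=> j; apply: contrapT => nov; apply: no; exists j => u Fu.
    by apply: contrapT => nNu; apply: nov; exists u.
  apply: (no_long_chains hchar hAV hGK (ms := gens) (K := 1%N) low_gens_Bop sub) => m m0.
  exists N, v; split=> [j _|i im|i j /andP[ij _]].
  - exact: dgen_dsub.
  - by have [Fv Nv] := vP i; split=> //; apply: (spn_CmM0_mono idl) Fv; rewrite mul1n.
  - by have [Fv _] := vP i; apply: dgen_incl; apply: (spn_CmM0_mono idl) Fv.
have dN : dsub actA rho (N j) by apply: dgen_dsub.
have NS : subspace (N j) by case: dN.
have low_stable : forall u, N j u -> forall (m : 'X_{1..n}) i, (mdeg m < 5)%N ->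
    N j (rho (mvf 'X_[m] i) u).
  (* [Q] is a D-submodule: the commutator of a low field with x_l is a multiplication operator, and
     with d_l a multiple of a low field. *)
  move=> u Nu; pose Q w := N j w /\ forall (m : 'X_{1..n}) i, (mdeg m < 5)%N ->
    N j (rho (mvf 'X_[m] i) w).
  suff [] : Q u by [].
  apply: Nu => [|y Fy]; last first.
    split; first exact: dgen_incl.
    move=> m i lt; apply: jP.
    have R : raises (CmM0 low_gens gens) (rho (mvf 'X_[m] i)).
      by apply: CmM0_raises; [exact: (rho_linop hAV _) | exact: mem_low_gens].
    exact: R Fy.
  have [_ Nx Nd] := dN; split.
  - split=> [|c y z [Ny Qy] [Nz Qz]].
      split=> [|m i _]; first by case: NS.
      by rewrite linop0; [case: NS | exact: (rho_linop hAV _)].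
    split=> [|m i lt]; first by case: NS => _; apply.
    by rewrite (rho_linop hAV); case: NS => _; apply; [exact: Qy | exact: Qz].
  - move=> l y [Ny Qy]; split=> [|m i lt]; first exact: Nx.
    rewrite (rho_actA hAV); apply: (subspaceD NS); first exact: (dsub_actA _ dN Ny).
    by apply: Nx; apply: Qy.
  - move=> l y [Ny Qy]; split=> [|m i lt]; first exact: Nd.
    rewrite -[rho (mvf _ _) _](subKr (d_ l (rho (mvf 'X_[m] i) y))) -(rho_brk hAV).
    apply: (subspaceB NS); first by apply: Nd; apply: Qy.
    rewrite (_ : der_bracket _ _ = mvf ((m l)%:R *: 'X_[m - U_(l)]) i).
      rewrite rho_mvfZ; apply: (subspaceZ _ NS); apply: Qy.
      exact: leq_ltn_trans (mdegB _ _) lt.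
    apply: Der_eq => p; rewrite bracket_mvf mvfE mderivX mul1r.
    by rewrite -mpolyC1 mderivC mulr0 mul0r subr0.
have all_stable := stable_rho NS (fun m i lt u Nu => low_stable u Nu m i lt).
exists (CmM0 low_gens gens j) => u.
suff Nu : N j u.
  apply: Nu => [|y]; first exact: dgen_dsub.
  by apply: spn_sub => [|z zg]; [case: (dgen_dsub (fun y => y \in CmM0 low_gens gens j)) | exact:
    dgen_incl].
apply: gensP u => [y yg||y z|c y|f y|eta y].
- apply: dgen_incl; apply: (spn_CmM0_mono idl (leq0n j)).
  by apply: mem_spn; rewrite CmM0_0.
- by case: NS.
- exact: (subspaceD NS).
- exact: (subspaceZ _ NS).
- exact: (dsub_actA _ dN).
- exact: all_stable.
Qed.

End FiniteGeneration.

(** * Endomorphisms of D-modules *)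

Section PolynomialsInOperator.
Variables (k : closedFieldType) (M : lmodType k).
Variables (E : M -> M).
Hypothesis EL : linop E.
Implicit Types (p q : {poly k}) (s : seq k).

Definition poly_op p u := \sum_(i < size p) p`_i *: iter i E u.

Lemma poly_opE p u m : (size p <= m)%N -> poly_op p u = \sum_(i < m) p`_i *: iter i E u.
Proof.
move=> le; rewrite /poly_op (big_ord_widen _ (fun i => p`_i *: iter i E u) le) big_mkcond /=.
apply: eq_bigr => i _; case: ltnP => // lei.
by rewrite nth_default // scale0r.
Qed.

Lemma poly_opD p q u : poly_op (p + q) u = poly_op p u + poly_op q u.
Proof.
have le1 : (size p <= maxn (size p) (size q))%N by rewrite leq_maxl.
have le2 : (size q <= maxn (size p) (size q))%N by rewrite leq_maxr.
rewrite (poly_opE u le1) (poly_opE u le2) (poly_opE u (size_polyD p q)) -big_split /=.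
by apply: eq_bigr => i _; rewrite coefD scalerDl.
Qed.

Lemma poly_opZ c p u : poly_op (c *: p) u = c *: poly_op p u.
Proof.
rewrite (poly_opE u (size_scale_leq c p)) scaler_sumr.
by apply: eq_bigr => i _; rewrite coefZ scalerA.
Qed.

Lemma poly_op0 u : poly_op 0 u = 0.
Proof. by rewrite /poly_op size_poly0 big_ord0. Qed.

Lemma poly_op_sum (I : Type) (r : seq I) (F : I -> {poly k}) u :
  poly_op (\sum_(i <- r) F i) u = \sum_(i <- r) poly_op (F i) u.
Proof.
apply: (big_morph (fun p => poly_op p u)); last exact: poly_op0.
by move=> p q; apply: poly_opD.
Qed.

Lemma poly_op_linop p : linop (poly_op p).
Proof.
move=> c u v; rewrite scaler_sumr -big_split /=; apply: eq_bigr => i _.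
by rewrite linop_iter // scalerDr !scalerA mulrC.
Qed.

Lemma poly_opC c u : poly_op c%:P u = c *: u.
Proof. by rewrite (poly_opE u (size_polyC_leq1 c)) big_ord1 coefC. Qed.

Lemma poly_opMX p u : poly_op (p * 'X) u = poly_op p (E u).
Proof.
have le : (size (p * 'X)%R <= (size p).+1)%N.
  by have [->|p0] := eqVneq p 0; rewrite ?mul0r ?size_poly0 // size_mulX.
rewrite (poly_opE u le) big_ord_recl coefMX eqxx scale0r add0r.
by apply: eq_bigr => i _; rewrite coefMX /= -iterSr.
Qed.

Lemma poly_opMXsubC p c u : poly_op (p * ('X - c%:P)) u = poly_op p (E u - c *: u).
Proof.
have -> : p * ('X - c%:P) = p * 'X + (- c) *: p.
  by rewrite mulrBr [p * c%:P]mulrC mul_polyC scaleNr.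
rewrite poly_opD poly_opMX poly_opZ scaleNr.
by rewrite (linopB _ _ (poly_op_linop p)) (linopZ _ _ (poly_op_linop p)).
Qed.

(** The product of the E - c for [c] in [s]. With the list of roots kept, adding a factor or
    shifting all roots is a list operation. *)
Definition eigen_prod s u := foldr (fun c v => E v - c *: v) u s.

Lemma eigen_prod_E s u : E (eigen_prod s u) = eigen_prod s (E u).
Proof. by elim: s => //= c s IH; rewrite (linopB _ _ EL) (linopZ _ _ EL) IH. Qed.

Lemma poly_op_prod s u : poly_op (\prod_(c <- s) ('X - c%:P)) u = eigen_prod (rev s) u.
Proof.
elim: s u => [|c s IH] u; first by rewrite big_nil poly_opC scale1r.
by rewrite big_cons mulrC poly_opMXsubC IH rev_cons /eigen_prod -cats1 foldr_cat.
Qed.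

(* A relation [sum_c a_c w_c = 0] becomes, after applying [prod_c (E - c)], a polynomial in [E]
  killing [v]. *)
Lemma resolvent_independent (N : M -> Prop) s (g : seq M) (w : k -> M) v :
  subspace N -> stable N E -> (forall c u, N u -> E u = c *: u -> u = 0) ->
  N v -> v != 0 -> (forall c, E (w c) - c *: w c = v) ->
  (forall c, c \in s -> spn g (w c)) -> uniq s -> (size s <= size g)%N.
Proof.
move=> NS NE inj Nv v0 wE wg us; rewrite leqNgt; apply/negP => lt.
have /choice [a aP] : forall i : 'I_(size s), exists l : nat -> k,
    w s`_i = \sum_(j < size g) l j *: g`_j.
  by move=> i; have [l ->] := wg _ (mem_nth 0 (ltn_ord i)); exists l.
have [|c [i0 nz] rel] := @linear_relation k 'I_(size s) 'I_(size g) (fun i j => a i j).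
  by rewrite !card_ord.
pose Q := \prod_(j < size s) ('X - (s`_j)%:P).
pose Qi (i : 'I_(size s)) := \prod_(j < size s | j != i) ('X - (s`_j)%:P).
have QE i : Q = Qi i * ('X - (s`_i)%:P) by rewrite /Q (bigD1 i) //= mulrC.
pose q := \sum_i c i *: Qi i.
have qv : poly_op q v = 0.
  rewrite poly_op_sum (eq_bigr (fun i : 'I_(size s) => c i *: poly_op Q (w s`_i))); last first.
    by move=> i _; rewrite poly_opZ (QE i) poly_opMXsubC wE.
  rewrite (eq_bigr (fun i => poly_op Q (c i *: w s`_i))); last first.
    by move=> i _; rewrite (linopZ _ _ (poly_op_linop Q)).
  rewrite -(linop_sum _ _ _ (poly_op_linop Q)).
  rewrite (eq_bigr (fun i => \sum_(j < size g) (c i * a i j) *: g`_j)); last first.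
    by move=> i _; rewrite aP scaler_sumr; apply: eq_bigr => j _; rewrite scalerA.
  rewrite exchange_big big1 /= => [|j _]; last by rewrite -scaler_suml rel scale0r.
  exact: linop0 (poly_op_linop Q).
(* At the root of index [i0] all summands but one vanish, and that one does not, the roots being
   distinct. *)
have q0 : q != 0.
  apply/eqP => /(congr1 (fun p => p.[s`_i0])); rewrite horner0 horner_sum (bigD1 i0) //= big1.
    rewrite addr0 hornerZ horner_prod => /eqP; rewrite mulf_eq0 (negPf nz) /=.
    apply/negP/prodf_neq0 => j ji; rewrite hornerXsubC subr_eq0 nth_uniq //.
    by rewrite eq_sym.
  move=> i ii0; rewrite hornerZ /Qi horner_prod (bigD1 i0) //=; last by rewrite eq_sym.
  by rewrite hornerXsubC subrr mul0r mulr0.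
(* Over an algebraically closed field [q] splits into factors E - b, each injective on [N], so it
   cannot kill [v]. *)
have [r qr] := closed_field_poly_normal q.
have : eigen_prod (rev r) v = 0.
  apply: (scalerI (a := lead_coef q)); first by rewrite lead_coef_eq0.
  by rewrite scaler0 -poly_op_prod -poly_opZ -qr qv.
have Ninj t : N (eigen_prod t v) /\ eigen_prod t v <> 0.
  elim: t => [|b t [Nt nt]] /=; first by split=> //; apply/eqP.
  split; first by apply: (subspaceB NS); [exact: NE | exact: (subspaceZ _ NS)].
  by move/eqP; rewrite subr_eq0 => /eqP /(inj _ _ Nt).
by case: (Ninj (rev r)).
Qed.

Lemma eigen_prod_linop s : linop (eigen_prod s).
Proof.
elim: s => [|c s IH] a u v //=.
by rewrite IH EL scalerDr opprD addrACA scalerBr !scalerA [c * a]mulrC.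
Qed.

Lemma eigen_prod_comm s s' u : eigen_prod s (eigen_prod s' u) = eigen_prod s' (eigen_prod s u).
Proof.
elim: s => //= c s ->.
by rewrite (linopB _ _ (eigen_prod_linop s')) (linopZ _ _ (eigen_prod_linop s')) eigen_prod_E.
Qed.

Lemma eigen_prod_eigenvector s c u : E u = c *: u ->
  eigen_prod s u = (\prod_(b <- s) (c - b)) *: u.
Proof.
move=> Eu; elim: s => [|b s IH]; first by rewrite big_nil scale1r.
by rewrite /= IH (linopZ _ _ EL) Eu big_cons !scalerA -scalerBl [b * _]mulrC -mulrBr mulrC.
Qed.

(** Coprimality without Bezout: applying all factors of [s] but the outermost leaves a vector on
    which E is the scalar [c], so the product over [s'] acts there by a nonzero scalar. *)
Lemma eigen_prod_disjoint s s' u : (forall c, c \in s -> c \notin s') ->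
  eigen_prod s u = 0 -> eigen_prod s' u = 0 -> u = 0.
Proof.
move=> dis Ps Ps'; elim: s dis Ps => // c s IH dis /eqP; rewrite /= subr_eq0 => /eqP Ey.
apply: IH => [b bs|]; first by apply: dis; rewrite inE bs orbT.
have := eigen_prod_eigenvector s' Ey; rewrite eigen_prod_comm Ps' (linop0 (eigen_prod_linop s)).
move/esym/eqP; rewrite scaler_eq0 => /orP[/eqP/eqP|/eqP //].
rewrite prodf_seq_eq0 => /hasP [b bs' /=]; rewrite subr_eq0 => /eqP cb.
by have := dis c (mem_head _ _); rewrite cb bs'.
Qed.

(** Factor by factor, (E - c - d) X = X (E - c). *)
Lemma eigen_prod_weight s d X u : linop X -> (forall v, E (X v) = X (E v) + d *: X v) ->
  eigen_prod [seq c + d | c <- s] (X u) = X (eigen_prod s u).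
Proof.
move=> XL EX; elim: s => //= c s ->.
by rewrite EX (linopB _ _ XL) (linopZ _ _ XL) scalerDl opprD [- _ - _]addrC addrA addrK.
Qed.

End PolynomialsInOperator.

Lemma bounded_uniq_finite (T : eqType) (P : T -> Prop) d :
  (forall s, uniq s -> (forall x, x \in s -> P x) -> (size s <= d)%N) ->
  exists s : seq T, forall x, P x -> x \in s.
Proof.
move=> bnd; apply: contrapT => no.
suff [s [us sP sd]] : exists s, [/\ uniq s, forall x, x \in s -> P x & size s = d.+1].
  by have := bnd s us sP; rewrite sd ltnn.
elim: d.+1 => [|j [s [us sP sj]]]; first by exists [::].
have [x Px xs] : exists2 x, P x & x \notin s.
  apply: contrapT => nx; apply: no; exists s => x Px; apply/negPn/negP => xs.
  by apply: nx; exists x.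
exists (x :: s); split=> /=; [by rewrite xs | | by rewrite sj].
by move=> y; rewrite inE => /predU1P[->|/sP].
Qed.

Lemma countable_union_finite (T : Type) (t0 : T) (f : nat -> seq T) :
  exists e : nat -> T, forall r i, (i < size (f r))%N -> exists j, e j = nth t0 (f r) i.
Proof.
exists (fun j => if unpickle j is Some p then nth t0 (f p.1) p.2 else t0) => r i _.
by exists (pickle (r, i)); rewrite pickleK.
Qed.

(** * Counting over an uncountable field and the annihilating polynomial *)

Section WeylEndomorphisms.
Variables (k : closedFieldType) (n : nat) (M : lmodType k).
Hypothesis hchar : [pchar k] =i pred0.
Hypothesis hunc : uncountable k.
Variables (actA : {mpoly k[n]} -> M -> M) (rho : Der k n -> M -> M).
Hypothesis hAV : isAVmodule actA rho.
Hypothesis hGK : GKdim actA rho = (n%:R : Rdefinitions.R)%:E.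

Local Notation weyl := (weyl_gens actA rho).
Local Notation dgens V := (dgen actA rho (fun y => y \in V)).

Definition weyl_linear (T : M -> M) := linop T /\ forall P, P \in weyl -> forall u, T (P u) = P
  (T u).

Lemma id_weyl : id \in weyl.
Proof. by rewrite inE eqxx. Qed.

Lemma mem_dgens_spn (V : seq M) u : dgens V u -> exists r, spn (CmM0 weyl V r) u.
Proof.
move=> Vu; apply: (Vu (fun u => exists r, spn (CmM0 weyl V r) u)) => [|y yV]; last by exists 0%N;
  apply: mem_spn; rewrite CmM0_0.
have raise P : P \in weyl -> stable (fun y => exists r, spn (CmM0 weyl V r) y) P.
  move=> wP y [r Fy]; exists r.+1.
  have R : raises (CmM0 weyl V) P by apply: CmM0_raises => //; exact: (weyl_linop hAV wP).
  exact: R Fy.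
split.
- split=> [|c x y [r Fx] [r' Fy]]; first by exists 0%N; case: (spn_subspace (CmM0 weyl V 0)).
  exists (maxn r r'); case: (spn_subspace (CmM0 weyl V (maxn r r'))) => _; apply.
    exact: (spn_CmM0_mono id_weyl (leq_maxl _ _) Fx).
  exact: (spn_CmM0_mono id_weyl (leq_maxr _ _) Fy).
- by move=> i; apply: raise; apply: mem_weyl_x.
- by move=> i; apply: raise; apply: mem_weyl_d.
Qed.

Lemma dsub_preim N T : dsub actA rho N -> weyl_linear T -> dsub actA rho (fun u => N (T u)).
Proof.
move=> dN [TL TC]; have [NS Nx Nd] := dN; split.
- exact: subspace_preim.
- by move=> i u Nu; rewrite TC ?mem_weyl_x //; apply: Nx.
- by move=> i u Nu; rewrite TC ?mem_weyl_d //; apply: Nd.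
Qed.

Lemma weyl_linear_iter T j : weyl_linear T -> weyl_linear (iter j T).
Proof.
move=> [TL TC]; split; first exact: linop_iter.
by move=> P wP u; elim: j => //= j ->; rewrite TC.
Qed.

Lemma dsub0 : dsub actA rho (fun u => u = 0).
Proof.
split; first exact: subspace0.
- by move=> i u ->; rewrite linop0 //; exact: (actA_linop hAV).
- by move=> i u ->; rewrite linop0 //; exact: (rho_linop hAV _).
Qed.

(* If [T v = 0], lifting [v] along powers of [T] gives [v_i] in [ker T^(i+1)] but not in [ker
  T^i], at linear pace. *)
Lemma surjective_injective (V : seq M) T v : weyl_linear T ->
  (forall y, dgens V y -> exists2 x, dgens V x & T x = y) ->
  dgens V v -> T v = 0 -> v = 0.
Proof.
move=> TW surj Vv Tv; have [TL TC] := TW; apply: contrapT => v0.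
(* Preimages of the finitely many generators fix the pace: [T] commutes with the Weyl generators, so
   lifting any vector costs the same [a] steps. *)
have [a aP] : exists a, forall y, y \in V -> exists2 w, spn (CmM0 weyl V a) w & T w = y.
  have sV : forall y, y \in V -> dgens V y by move=> y; apply: dgen_incl.
  elim: {1 3}V sV => [|y s IH] sV; first by exists 0%N.
  have [|a aP] := IH; first by move=> z zs; apply: sV; rewrite inE zs orbT.
  have [w Vw Tw] := surj y (sV y (mem_head _ _)).
  have [b Fb] := mem_dgens_spn Vw; exists (maxn a b) => z; rewrite inE => /predU1P[->|/aP [w' Fw'
    <-]].
    by exists w => //; apply: (spn_CmM0_mono id_weyl (leq_maxr _ _) Fb).
  by exists w' => //; apply: (spn_CmM0_mono id_weyl (leq_maxl _ _) Fw').
have lift : forall r y, spn (CmM0 weyl V r) y -> exists2 w, spn (CmM0 weyl V (r + a)) w & T w = y.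
  apply: (CmM0_ind (P := fun r y => exists2 w, spn (CmM0 weyl V (r + a)) w & T w = y)).
  - move=> r; have [S0 SL] := spn_subspace (CmM0 weyl V (r + a)).
    split=> [|c x y [w Fw <-] [w' Fw' <-]]; first by exists 0 => //; rewrite linop0.
    by exists (c *: w + w'); [exact: SL | rewrite TL].
  - exact: aP.
  - move=> P r y wP [w Fw <-]; exists (P w); last by rewrite TC.
    have R : raises (CmM0 weyl V) P by apply: CmM0_raises => //; exact: (weyl_linop hAV wP).
    by rewrite addSn; apply: R.
have [b Fb] := mem_dgens_spn Vv.
have /choice [w wP] : forall i, exists w, spn (CmM0 weyl V (b + i * a)) w /\ iter i T w = v.
  elim=> [|i [w [Fw wv]]]; first by exists v; rewrite addn0.
  have [w' Fw' Tw'] := lift _ _ Fw; exists w'; split; last by rewrite iterSr Tw'.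
  by rewrite mulSn addnCA addnC.
apply: (no_long_chains hchar hAV hGK (cs := weyl) (ms := V) (K := (b + a)%N)).
- move=> c /weyl_gensP[->|[i ->]|[i ->]]; [exact: Bop_id|exact: Bop_A|exact: Bop_V].
- by [].
move=> m m0; exists (fun j u => iter j T u = 0), w; split.
- by move=> j _; apply: (dsub_preim dsub0); apply: weyl_linear_iter.
- move=> i im; have [Fw wv] := wP i; split; last by rewrite wv.
  apply: (spn_CmM0_mono id_weyl _ Fw); rewrite mulnDl leq_add //; last by rewrite mulnC leq_mul2l
    ltnW ?orbT.
  by rewrite leq_pmulr.
- move=> i j /andP[ij _]; have [_ wv] := wP i.
  rewrite -(subnK (ltnW ij)) iterD wv.
  move: ij; rewrite -subn_gt0; case: (j - i)%N => // d _.
  by rewrite iterSr Tv linop0 //; exact: linop_iter.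
Qed.

Variable E : M -> M.
Hypothesis EW : weyl_linear E.
Hypothesis EB : Bop actA rho E.

Let EL : linop E. Proof. by case: EW. Qed.

Lemma shift_linop c : linop (fun u => E u - c *: u).
Proof.
by move=> a u v; rewrite EL scalerDr opprD addrACA scalerBr !scalerA [c * a]mulrC.
Qed.

Lemma weyl_linear_shift c : weyl_linear (fun u => E u - c *: u).
Proof.
split=> [|P wP u]; first exact: shift_linop.
have PL := weyl_linop hAV wP.
by case: EW => _ EC; rewrite (linopB _ _ PL) (linopZ _ _ PL) EC.
Qed.

(** If all E - c were surjective, hence injective, each [c] would have a [w c] sent to [v] by E - c.
    By [resolvent_independent] a filtration piece contains [w c] for finitely many [c] only, and
    countably many pieces exhaust the submodule, so [k] would be countable. *)
Lemma exists_nonsurjective_shift (V : seq M) v : dgens V v -> v != 0 ->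
  stable (dgens V) E ->
  exists c, ~ forall y, dgens V y -> exists2 x, dgens V x & E x - c *: x = y.
Proof.
move=> Vv v0 VE; apply: contrapT => no.
have surj c y : dgens V y -> exists2 x, dgens V x & E x - c *: x = y.
  by move: y; apply: contrapT => nc; apply: no; exists c.
have inj c u : dgens V u -> E u = c *: u -> u = 0.
  move=> Vu Eu; apply: (surjective_injective (weyl_linear_shift c) (surj c) Vu).
  by rewrite Eu subrr.
have /choice [w wP] : forall c, exists w, dgens V w /\ E w - c *: w = v.
  by move=> c; have [w] := surj c v Vv; exists w.
have /choice [f fP] : forall r, exists s : seq k, forall c, spn (CmM0 weyl V r) (w c) -> c \in s.
  move=> r; apply: (@bounded_uniq_finite _ _ (size (CmM0 weyl V r))) => s us sF.
  have [VS _ _] := dgen_dsub actA rho (fun y => y \in V).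
  by apply: (resolvent_independent EL VS VE inj Vv v0 _ sF us) => c; case: (wP c).
have [e eP] := countable_union_finite 0 f.
apply: hunc; exists e => c; have [Vw _] := wP c.
have [r /fP cf] := mem_dgens_spn Vw.
by have [|j ej] := eP r (index c (f r)); [rewrite index_mem | exists j; rewrite ej nth_index].
Qed.

Local Notation Pop := (eigen_prod E).

Lemma weyl_linear_eigen_prod s : weyl_linear (Pop s).
Proof.
elim: s => [|c s [SL SC]]; first by split.
have [cL cC] := weyl_linear_shift c; split=> [a u v|P wP u] /=.
  by rewrite SL cL.
by rewrite SC // cC.
Qed.

Lemma eigen_prod_cons c s u : Pop (c :: s) u = Pop s (E u - c *: u).
Proof.
have [SL _] := weyl_linear_eigen_prod s.
by rewrite (linopB _ _ SL) (linopZ _ _ SL) -(eigen_prod_E EL).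
Qed.

(** Makes the image of [Pop s] finitely generated over D, so that [exists_nonsurjective_shift]
    applies to it. *)
Lemma dgens_map_eigen_prod (V : seq M) s u : (forall u, dgens V u) ->
  dgens [seq Pop s y | y <- V] u <-> exists w, u = Pop s w.
Proof.
move=> VM; have sW := weyl_linear_eigen_prod s; split.
  have [SL SC] := sW; move/(_ (fun u => exists w, u = Pop s w)); apply=> [|y /mapP [z _ ->]];
    last by exists z.
  split.
  - split=> [|c x y [w ->] [w' ->]]; first by exists 0; rewrite linop0.
    by exists (c *: w + w'); rewrite SL.
  - by move=> i y [w ->]; exists (actA 'X_i w); rewrite SC ?mem_weyl_x.
  - by move=> i y [w ->]; exists (rho (pd k i) w); rewrite SC ?mem_weyl_d.
move=> [w ->]; apply: (VM w (fun w => dgens [seq Pop s y | y <- V] (Pop s w))) => [|y yV].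
  by apply: dsub_preim => //; exact: dgen_dsub.
by apply: dgen_incl; apply: map_f.
Qed.

(* Otherwise uncountability yields [c_1, c_2, ...] making the images of [prod_(i <= j) (E - c_i)]
  strictly decreasing. *)
Lemma exists_annihilator (V : seq M) : (forall u, dgens V u) ->
  exists s, forall u, Pop s u = 0.
Proof.
move=> VM; apply: contrapT => no.
(* The witness is taken as [Pop s] of one of the generators in [V]: it is reached by [size s] uses
   of E, which secures linear speed. *)
have next s : exists p : k * M, p.2 \in V /\ ~ exists w, Pop s p.2 = Pop (p.1 :: s) w.
  have [u0 Pu0] : exists u, Pop s u != 0.
    apply: contrapT => nu; apply: no; exists s => u; apply: contrapT => /eqP Pu.
    by apply: nu; exists u.
  have im u := @dgens_map_eigen_prod V s u VM.
  have [|//|u|c nc] := @exists_nonsurjective_shift [seq Pop s y | y <- V] (Pop s u0).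
  - by apply/im; exists u0.
  - by move/im => [w ->]; apply/im; exists (E w); rewrite (eigen_prod_E EL).
  apply: contrapT => no2; apply: nc => y /im [w ->].
  suff [w' E'] : exists w', Pop s w = Pop (c :: s) w'.
    by exists (Pop s w') => //; apply/im; exists w'.
  have [SL SC] := weyl_linear_eigen_prod s.
  have [cL cC] := weyl_linear_eigen_prod (c :: s).
  apply: (VM w (fun w => exists w', Pop s w = Pop (c :: s) w')) => [|z zV]; last first.
    by apply: contrapT => nz; apply: no2; exists (c, z).
  split.
  - split=> [|a x x' [y1 e1] [y2 e2]]; first by exists 0; rewrite !linop0.
    by exists (a *: y1 + y2); rewrite SL cL e1 e2.
  - by move=> i x [y1 e1]; exists (actA 'X_i y1); rewrite (SC _ (mem_weyl_x _ _ i)) (cC _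
    (mem_weyl_x _ _ i)) e1.
  - by move=> i x [y1 e1]; exists (rho (pd k i) y1); rewrite (SC _ (mem_weyl_d _ _ i)) (cC _
    (mem_weyl_d _ _ i)) e1.
have /choice [f fP] := next.
pose s := fix s j := if j is j'.+1 then (f (s j')).1 :: s j' else [::] : seq k.
pose v j := Pop (s j) (f (s j)).2.
pose I j u := exists w, u = Pop (s j) w.
have I_mono j j' u : (j <= j')%N -> I j' u -> I j u.
  move=> /subnK <-; elim: (j' - j)%N => // d IH [w uE]; apply: IH.
  by exists (E w - (f (s (d + j)%N)).1 *: w); rewrite uE -eigen_prod_cons.
(* E may join the operators that measure growth because of [EB]; the witness [v j] then lies in
   piece [j]. *)
have Ecs : E \in E :: weyl by rewrite inE eqxx.
have idcs : id \in E :: weyl by rewrite inE id_weyl orbT.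
have RE : raises (CmM0 (E :: weyl) V) E by apply: CmM0_raises.
have Fv j : spn (CmM0 (E :: weyl) V j) (v j).
  have Fp u : spn (CmM0 (E :: weyl) V 0) u -> spn (CmM0 (E :: weyl) V j) (Pop (s j) u).
    move=> Fu; elim: j => [//|j IH]; have FS := spn_subspace (CmM0 (E :: weyl) V j.+1).
    apply: (subspaceB FS); first exact: RE.
    by apply: (subspaceZ _ FS); apply: CmM0_mono.
  by apply: Fp; apply: mem_spn; rewrite CmM0_0; case: (fP (s j)).
apply: (no_long_chains hchar hAV hGK (cs := E :: weyl) (ms := V) (K := 1%N)).
- move=> c; rewrite inE => /predU1P[-> //|].
  case/weyl_gensP=> [->|[i ->]|[i ->]]; [exact: Bop_id|exact: Bop_A|exact: Bop_V].
- by move=> c cw; rewrite inE cw orbT.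
(* The images decrease, so for each [m] the first [m] steps are read backwards. *)
move=> m m0; exists (fun i => I (m - i)%N), (fun i => v (m - i.+1)%N); split.
- move=> j _; have [SL SC] := weyl_linear_eigen_prod (s (m - j)%N); split.
  + split=> [|a x y [w ->] [w' ->]]; first by exists 0; rewrite linop0.
    by exists (a *: w + w'); rewrite SL.
  + by move=> i y [w ->]; exists (actA 'X_i w); rewrite SC ?mem_weyl_x.
  + by move=> i y [w ->]; exists (rho (pd k i) w); rewrite SC ?mem_weyl_d.
- move=> i im; split.
    by apply: (spn_CmM0_mono idcs _ (Fv _)); rewrite mul1n leq_subr.
  move=> Iv; case: (fP (s (m - i.+1)%N)) => _; apply.
  by move: Iv; rewrite -subSS subSn.
- move=> i j /andP[ij jm]; apply: (@I_mono _ (m - i.+1)%N).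
    by rewrite leq_sub2l.
  by exists (f (s (m - i.+1)%N)).2.
Qed.

End WeylEndomorphisms.

(** * Iterated commutators with coordinates *)

Section IteratedDeltas.
Variables (k : closedFieldType) (n : nat) (M : lmodType k).
Variables (actA : {mpoly k[n]} -> M -> M) (rho : Der k n -> M -> M).
Hypothesis hAV : isAVmodule actA rho.
Implicit Types (w : seq 'I_n) (f g : {mpoly k[n]}) (eta xi : Der k n) (D : Der k n -> M -> M).

Definition ddelta w D := foldr (fun j D' => delta actA 'X_j D') D w.

Lemma deltaE f D eta u : delta actA f D eta u = D (derScale f eta) u - actA f (D eta u).
Proof. by []. Qed.

Lemma ddelta_cons j w D eta u : ddelta (j :: w) D eta u =
  ddelta w D (derScale 'X_j eta) u - actA 'X_j (ddelta w D eta u).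
Proof. by []. Qed.

Definition vanishes_at t D := forall w, size w = t -> forall eta u, ddelta w D eta u = 0.

Lemma ddelta0 w eta u : ddelta w (fun _ _ => 0) eta u = 0.
Proof.
elim: w eta u => //= j w IH eta u.
by rewrite deltaE !IH linop0 ?subr0 //; exact: (actA_linop hAV).
Qed.

Lemma ddeltaD w D D' eta u :
  ddelta w (fun eta u => D eta u + D' eta u) eta u = ddelta w D eta u + ddelta w D' eta u.
Proof.
elim: w eta u => //= j w IH eta u.
by rewrite !deltaE !IH (linopD _ _ (actA_linop hAV _)) opprD addrACA.
Qed.

Lemma ddelta_actA w f D eta u :
  ddelta w (fun eta u => actA f (D eta u)) eta u = actA f (ddelta w D eta u).
Proof.
elim: w eta u => //= j w IH eta u.
by rewrite !deltaE !IH (linopB _ _ (actA_linop hAV _)) (actA_comm hAV).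
Qed.

Lemma ddelta_derScale w f D eta u :
  ddelta w (fun eta u => D (derScale f eta) u) eta u = ddelta w D (derScale f eta) u.
Proof.
elim: w eta u => //= j w IH eta u.
by rewrite !deltaE !IH !derScaleA mulrC.
Qed.

Lemma der_klinear_comb D c eta xi u : der_klinear D ->
  D (der_comb c eta xi) u = c *: D eta u + D xi u.
Proof. by apply. Qed.

Lemma derScale_comb f c eta xi :
  derScale f (der_comb c eta xi) = der_comb c (derScale f eta) (derScale f xi).
Proof. by apply: Der_eq => p; rewrite derScaleE !der_combE mulrDr !derScaleE scalerAr. Qed.

Lemma delta_klinear f D : der_klinear D -> der_klinear (delta actA f D).
Proof.
move=> DL c eta xi zeta E u.
rewrite (_ : zeta = der_comb c eta xi); last exact: Der_eq.
rewrite !deltaE derScale_comb !der_klinear_comb // (actA_linop hAV) scalerBr.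
by rewrite opprD addrACA.
Qed.

Lemma ddelta_klinear w D : der_klinear D -> der_klinear (ddelta w D).
Proof. by move=> DL; elim: w => //= j w; apply: delta_klinear. Qed.

(** In [f], [delta] is additive and zero on constants, and for a product [p * q] it is [delta] of
    [p] precomposed with [q], plus [p] times [delta] of [q]. Hence commutators with coordinates
    decide. *)
Lemma vanishes_delta t f D : der_klinear D ->
  vanishes_at t.+1 D -> vanishes_at t (delta actA f D).
Proof.
move=> DL Z; have ext D1 D2 : (forall eta u, D1 eta u = D2 eta u) ->
    vanishes_at t D1 -> vanishes_at t D2.
  by move=> e; rewrite (_ : D1 = D2) //; apply/funext => eta; apply/funext.
elim/mpoly_ring_ind: f => [c|i|p q Zp Zq|p q Zp Zq].
- apply: (ext (fun _ _ => 0)) => [eta u|w _ eta u]; last exact: ddelta0.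
  rewrite deltaE (actAC hAV) (DL c eta (vf (fun=> 0))) => [|p].
    rewrite (_ : D (vf _) u = 0) ?addr0 ?subrr // (DL (-1) (vf (fun=> 0)) (vf (fun=> 0))).
      by rewrite scaleN1r addNr.
    by move=> p; rewrite scaleN1r addNr vfE big1 // => j _; rewrite mul0r.
  by rewrite derScaleE mul_mpolyC vfE big1 ?addr0 // => j _; rewrite mul0r.
- move=> w sw eta u; have := Z (rcons w i); rewrite size_rcons sw => /(_ erefl eta u).
  by rewrite /ddelta -cats1 foldr_cat.
- apply: (ext (fun eta u => delta actA p D eta u + delta actA q D eta u)) => [eta u|w sw eta u].
    rewrite !deltaE (actAD hAV) opprD addrACA; congr (_ + _).
    rewrite (DL 1 (derScale p eta) (derScale q eta) (derScale (p + q) eta)) ?scale1r // => r.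
    by rewrite !derScaleE scale1r mulrDl.
  by rewrite ddeltaD Zp // Zq // addr0.
- apply: (ext (fun eta u => delta actA p D (derScale q eta) u + actA p (delta actA q D eta u))).
    move=> eta u; rewrite !deltaE derScaleA (actAM hAV) (linopB _ _ (actA_linop hAV _)).
    by rewrite addrA subrK.
  move=> w sw eta u; rewrite ddeltaD ddelta_derScale ddelta_actA Zp // Zq // add0r.
  exact: linop0 (actA_linop hAV _).
Qed.

Lemma vanishes_DiffS t D : der_klinear D -> vanishes_at t D -> DiffS actA t D.
Proof.
elim: t D => [|t IH] D DL Z; first exact: (Z [::]).
by move=> f; apply: IH; [exact: delta_klinear | exact: vanishes_delta].
Qed.

Lemma rho_klinear : der_klinear rho.
Proof. by move=> c eta xi zeta E u; apply: (rho_klin hAV). Qed.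

Local Notation DD w := (ddelta w rho).

Lemma DD_comb w c eta xi u : DD w (der_comb c eta xi) u = c *: DD w eta u + DD w xi u.
Proof. by apply: der_klinear_comb; apply: ddelta_klinear; apply: rho_klinear. Qed.

Lemma DD_zero w eta u : proj1_sig eta =1 (fun=> 0) -> DD w eta u = 0.
Proof.
move=> e0; rewrite (_ : eta = der_comb (-1) eta eta).
  by rewrite DD_comb scaleN1r addNr.
by apply: Der_eq => p; rewrite der_combE e0 addr0 scaler0.
Qed.

Lemma DD_linop w eta : linop (DD w eta).
Proof.
elim: w eta => [|j w IH] eta; first exact: (rho_linop hAV).
move=> c u v; rewrite /= !deltaE !IH (actA_linop hAV) scalerBr.
by rewrite opprD addrACA.
Qed.

(** One commutator is enough: rho(x_j eta) and x_j rho(eta) have the same Leibniz term x_j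
    eta(f). *)
Lemma DD_actA j w eta f u : DD (j :: w) eta (actA f u) = actA f (DD (j :: w) eta u).
Proof.
elim: w j eta => [|j' w IH] j eta.
  rewrite /= !deltaE !(rho_actA hAV) (linopD _ _ (actA_linop hAV _)) derScaleE (actAM hAV).
  by rewrite opprD addrACA subrr add0r (linopB _ _ (actA_linop hAV _)) (actA_comm hAV f).
rewrite !(ddelta_cons j (j' :: w)) !IH.
move: (DD (j' :: w) (derScale _ eta) u) (DD (j' :: w) eta u) => a b.
by rewrite (linopB _ _ (actA_linop hAV f)) (actA_comm hAV 'X_j f).
Qed.

(* Covers the translations [pd l] and the Euler field at once. *)
Lemma rho_DD_affine (c b : 'I_n -> k) xi w eta u :
  (forall j, proj1_sig xi 'X_j = c j *: 'X_j + (b j)%:MP) ->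
  rho xi (DD w eta u) =
    DD w eta (rho xi u) + DD w (der_bracket xi eta) u + (\sum_(j <- w) c j) *: DD w eta u.
Proof.
move=> xiE; elim: w eta u => [|j w IH] eta u.
  by rewrite /= (rho_brk hAV) big_nil scale0r addr0 addrC subrK.
rewrite /= !deltaE (linopB _ _ (rho_linop hAV _)) (rho_actA hAV) !IH.
(* [xi, x_j eta] = xi(x_j) eta + x_j [xi, eta]. The constants [b j] cancel against the Leibniz term
   of x_j; the [c j] accumulate in the weight. *)
rewrite (_ : der_bracket xi (derScale 'X_j eta) = der_comb (c j) (derScale 'X_j eta)
     (der_comb (b j) eta (derScale 'X_j (der_bracket xi eta)))); last first.
  apply: Der_eq => p; rewrite der_bracketE !der_combE !derScaleE der_bracketE derM xiE.
  by rewrite -!mul_mpolyC; ring.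
rewrite !DD_comb xiE (actAD hAV) (actAZ hAV) (actAC hAV) big_cons.
have AL := actA_linop hAV 'X_j.
rewrite !(linopD _ _ AL) (linopZ _ _ AL) scalerDl !scalerBr.
rewrite !opprD !addrA.
rewrite [LHS](ACl ((1*8)*(4*9)*((2*6)*(5*10))*(3*7)))%AC /= subrr addr0.
by rewrite !addrA.
Qed.

End IteratedDeltas.

Lemma natr_avoids (k : fieldType) (s : seq k) : [pchar k] =i pred0 ->
  exists t0, forall t, (t0 <= t)%N -> t%:R \notin s.
Proof.
move=> hchar; elim: s => [|c s [t0 t0P]]; first by exists 0%N.
have [[t1 t1c]|no] := pselect (exists t1 : nat, t1%:R = c).
  exists (maxn t0 t1.+1) => t; rewrite geq_max => /andP[le0 le1].
  rewrite inE negb_or t0P // andbT -t1c -subr_eq0 -natrB; last exact: ltnW.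
  by rewrite (proj1 (pcharf0P k) hchar) subn_eq0 -ltnNge.
exists t0 => t le; rewrite inE negb_or t0P // andbT.
by apply/eqP => tc; apply: no; exists t.
Qed.

(** * The Euler element and its weights *)

Section Euler.
Variables (k : closedFieldType) (n : nat) (M : lmodType k).
Hypothesis hchar : [pchar k] =i pred0.
Hypothesis hunc : uncountable k.
Variables (actA : {mpoly k[n]} -> M -> M) (rho : Der k n -> M -> M).
Hypothesis hAV : isAVmodule actA rho.
Implicit Types (w : seq 'I_n) (eta : Der k n).

Local Notation x_ i := (actA 'X_i).
Local Notation d_ i := (rho (pd k i)).
Local Notation DD w := (ddelta actA w rho).

Definition euler : Der k n := vf (fun i => 'X_i).

(* The Euler field of the isotropy factor in [A # U(V) = D (x) U(L_+)]. *)
Definition isotropy_euler (u : M) := rho euler u - \sum_i x_ i (d_ i u).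

Lemma euler_linop : linop isotropy_euler.
Proof.
move=> c u v; rewrite /isotropy_euler (rho_linop hAV) scalerBr scaler_sumr addrACA -opprD.
congr (_ - _); rewrite -big_split /=; apply: eq_bigr => i _.
by rewrite (rho_linop hAV) (actA_linop hAV).
Qed.

Lemma pdX (l j : 'I_n) : proj1_sig (pd k l) 'X_j = 0 *: 'X_j + ((j == l)%:R)%:MP.
Proof.
by rewrite pdE mderivXi scale0r add0r; case: eqP => _; rewrite ?mpolyC1 ?mpolyC0.
Qed.

Lemma eulerX (j : 'I_n) : proj1_sig euler 'X_j = 1 *: 'X_j + (0 : k)%:MP.
Proof.
rewrite vfE (bigD1 j) //= mderivXi eqxx mulr1 big1 => [|i ij].
  by rewrite scale1r mpolyC0.
by rewrite mderivXi eq_sym (negPf ij) mulr0.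
Qed.

Lemma bracket_pd_euler (l : 'I_n) : der_bracket (pd k l) euler = pd k l.
Proof.
apply: der_eq_on_vars => j; rewrite der_bracketE eulerX pdX !(scale0r, scale1r) mpolyC0 !addr0
  add0r.
by rewrite derC subr0 pdX scale0r add0r.
Qed.

(** [rho euler] and the sum of the x_i d_i have the same commutator with d_l, and likewise with
    every [f], so their difference is D-linear. *)
Lemma euler_pd l u : isotropy_euler (d_ l u) = d_ l (isotropy_euler u).
Proof.
have dL := rho_linop hAV (pd k l).
rewrite /isotropy_euler (linopB _ _ dL) (linop_sum _ _ _ dL).
have -> : d_ l (rho euler u) = rho euler (d_ l u) + d_ l u.
  by have := rho_brk hAV (pd k l) euler u; rewrite bracket_pd_euler => {2}->; rewrite addrC subrK.
have -> : \sum_i d_ l (x_ i (d_ i u)) = \sum_i x_ i (d_ i (d_ l u)) + d_ l u.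
  rewrite (eq_bigr (fun i => x_ i (d_ i (d_ l u)) + (l == i)%:R *: d_ i u)); last first.
    by move=> i _; rewrite (d_x hAV) (d_comm hAV).
  rewrite big_split /=; congr (_ + _); rewrite (bigD1 l) //= eqxx scale1r big1 ?addr0 //.
  by move=> i; rewrite eq_sym => /negPf ->; rewrite scale0r.
by rewrite opprD addrACA subrr addr0.
Qed.

Lemma euler_actA f u : isotropy_euler (actA f u) = actA f (isotropy_euler u).
Proof.
have fL := actA_linop hAV f.
rewrite /isotropy_euler (linopB _ _ fL) (linop_sum _ _ _ fL) (rho_actA hAV).
have -> : \sum_i x_ i (d_ i (actA f u)) =
    actA (proj1_sig euler f) u + \sum_i actA f (x_ i (d_ i u)).
  rewrite vfE (big_morph (fun p => actA p u) (fun p q => actAD hAV p q u) (actA0 hAV u)).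
  rewrite -big_split /=; apply: eq_bigr => i _.
  rewrite (rho_actA hAV) pdE (linopD _ _ (actA_linop hAV _)) (actAM hAV).
  by rewrite (actA_comm hAV f).
by rewrite opprD addrACA subrr add0r.
Qed.

Lemma euler_weyl_linear : weyl_linear actA rho isotropy_euler.
Proof.
split=> [|P wP u]; first exact: euler_linop.
case/weyl_gensP: wP => [->|[i ->]|[i ->]] //; first exact: euler_actA.
exact: euler_pd.
Qed.

Lemma euler_Bop : Bop actA rho isotropy_euler.
Proof.
have BS (r : seq 'I_n) : Bop actA rho (fun u => \sum_(i <- r) x_ i (d_ i u)).
  elim: r => [|i r IH].
    apply: (Bop_ext (T := fun u => 0 *: u)); last exact: Bop_scale (Bop_id _ _).
    by move=> u; rewrite big_nil scale0r.
  apply: (Bop_ext (T := fun u => (x_ i \o d_ i) u + \sum_(i <- r) x_ i (d_ i u))).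
    by move=> u; rewrite big_cons.
  by apply: Bop_add => //; apply: Bop_comp; [exact: Bop_A | exact: Bop_V].
apply: (Bop_ext (T := fun u => rho euler u + -1 *: \sum_i x_ i (d_ i u))).
  by move=> u; rewrite scaleN1r.
by apply: Bop_add; [exact: Bop_V | apply: Bop_scale; exact: BS].
Qed.

Lemma DD_pd_comm w b l u : d_ l (DD w (pd k b) u) = DD w (pd k b) (d_ l u).
Proof.
rewrite (rho_DD_affine hAV _ _ _ (pdX l)) big1 ?scale0r ?addr0 //.
rewrite [DD w (der_bracket _ _) u](DD_zero hAV) ?addr0 // => p.
by rewrite der_bracketE !pdE mderiv_comm subrr.
Qed.

Lemma bracket_euler_pd (b : 'I_n) : der_bracket euler (pd k b) = der_comb (-1) (pd k b) (vf
  (fun=> 0)).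
Proof.
apply: Der_eq => p; rewrite -[in RHS](bracket_pd_euler b) der_combE !der_bracketE scaleN1r opprB.
by rewrite vfE big1 ?addr0 // => i _; rewrite mul0r.
Qed.

(** The [size w + 1] coordinates contribute 1 each and d_b contributes -1, while the sum of the x_i
    d_i commutes with this operator. The weight is thus the word length less one. *)
Lemma euler_DD j w b u : isotropy_euler (DD (j :: w) (pd k b) u) =
  DD (j :: w) (pd k b) (isotropy_euler u) + (size w)%:R *: DD (j :: w) (pd k b) u.
Proof.
have XL := DD_linop hAV (j :: w) (pd k b).
rewrite /isotropy_euler (linopB _ _ XL) (linop_sum _ _ _ XL).
rewrite (rho_DD_affine hAV _ _ _ eulerX) bracket_euler_pd (DD_comb hAV).
rewrite [DD _ (vf _) u](DD_zero hAV) => [|p]; last first.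
  by rewrite vfE big1 // => i _; rewrite mul0r.
rewrite big_const_seq count_predT iter_addr_0 scaleN1r addr0 [size (j :: w)]/= mulrSr scalerDl
  scale1r.
have -> : \sum_i x_ i (d_ i (DD (j :: w) (pd k b) u)) =
    \sum_i DD (j :: w) (pd k b) (x_ i (d_ i u)).
  by apply: eq_bigr => i _; rewrite DD_pd_comm (DD_actA hAV).
set a := DD _ _ (rho euler u); set c := DD _ _ u; set S := \sum_i _.
by rewrite [_ *: c + c]addrC addrA addrNK addrAC.
Qed.

Hypothesis hGK : GKdim actA rho = (n%:R : Rdefinitions.R)%:E.
Hypothesis hfg : fin_gen actA rho.

Lemma DD_pd_vanishes : exists t0, forall w b u, (t0 < size w)%N -> DD w (pd k b) u = 0.
Proof.
have [V VM] := weyl_finitely_generated hchar hAV hGK hfg.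
have [s sP] := exists_annihilator hchar hunc hAV hGK euler_weyl_linear euler_Bop VM.
(* Beyond [t0] no integer is a difference of two roots, so shifting the roots by it makes them
   disjoint from the old ones. *)
have [t0 t0P] := natr_avoids [seq c' - c | c' <- s, c <- s] hchar.
(* The strict bound excludes the empty word and leaves weight [size w] at least [t0]. *)
exists t0 => -[//|j w] b u; rewrite ltnS => le.
apply: (@eigen_prod_disjoint _ _ isotropy_euler euler_linop [seq c + (size w)%:R | c <- s] s).
- move=> _ /mapP [c cs ->]; apply/negP => c's.
  have /negP := t0P _ le; apply; apply/allpairsP; exists (c + (size w)%:R, c).
  by split=> //=; rewrite addrAC subrr add0r.
- rewrite (@eigen_prod_weight _ _ _ s _ (DD (j :: w) (pd k b))).
  + by rewrite sP; apply: linop0 (DD_linop hAV (j :: w) (pd k b)).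
  + exact: (DD_linop hAV (j :: w) (pd k b)).
  + by move=> v; apply: euler_DD.
- exact: sP.
Qed.

(** Passes from d_b to f d_b: DD w (x_i eta) is DD (i :: w) eta plus x_i DD w eta, and both vanish
    for long [w]. *)
Lemma DD_vanishes : exists t0, forall w eta u, (t0 < size w)%N -> DD w eta u = 0.
Proof.
have [t0 t0P] := DD_pd_vanishes; exists t0.
pose S eta := forall w u, (t0 < size w)%N -> DD w eta u = 0.
have SC c eta xi : S eta -> S xi -> S (der_comb c eta xi).
  by move=> Se Sx w u lt; rewrite (DD_comb hAV) Se // Sx // scaler0 addr0.
have S0 eta : proj1_sig eta =1 (fun=> 0) -> S eta.
  by move=> e0 w u _; rewrite (DD_zero hAV).
have SA f eta : S eta -> S (derScale f eta).
  move=> Se; elim/mpoly_ring_ind: f eta Se => [c|i|p q Sp Sq|p q Sp Sq] eta Se.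
  - rewrite (_ : derScale _ _ = der_comb c eta (vf (fun=> 0))).
      apply: SC => //; apply: S0 => p; rewrite vfE big1 // => i _; rewrite mul0r //.
    apply: Der_eq => p; rewrite derScaleE der_combE mul_mpolyC vfE big1 ?addr0 // => i _.
    by rewrite mul0r.
  - move=> w u lt; have := Se (i :: w) u (ltnW lt).
    by rewrite ddelta_cons (Se w) // linop0 ?subr0 //; apply: (actA_linop hAV).
  - rewrite (_ : derScale _ _ = der_comb 1 (derScale p eta) (derScale q eta)).
      by apply: SC; [exact: Sp | exact: Sq].
    by apply: Der_eq => r; rewrite der_combE !derScaleE scale1r mulrDl.
  - by rewrite -derScaleA; apply: Sp; apply: Sq.
suff Sall eta : S eta by move=> w eta u; apply: Sall.
apply: der_ind => // m i; rewrite -[X in mvf X i]mulr1 -derScale_mvf.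
by apply: SA => w u lt; apply: t0P.
Qed.

End Euler.

Theorem theorem4p4 (k : closedFieldType) (hchar : [pchar k] =i pred0)
  (hunc : uncountable k) (n : nat) (M : lmodType k)
  (actA : {mpoly k[n]} -> M -> M) (rho : Der k n -> M -> M)
  (hAV : isAVmodule actA rho) (hhol : holonomic actA rho) :
  exists s : nat, Diff actA s rho.
Proof.
have rhoL := rho_klinear hAV.
case: hhol => hfg [M0|hGK].
  by exists 0%N; split=> //= f eta u; apply: M0.
have [t tP] := DD_vanishes hchar hunc hAV hGK hfg.
exists t; split=> //; apply: (vanishes_DiffS hAV rhoL) => w sw eta u.
by apply: tP; rewrite sw.
Qed.
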